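(* Let $A,B$ be finite-dimensional systems and let $U_{AB}$ be a unitary of the form $$U_{AB}=\big(V_A^{(1)}\otimes V_B^{(2)}\big)\Big(\sum_k u_k\,(L_k)_A\otimes(R_k)_B\Big)\big(V_A^{(3)}\otimes V_B^{(4)}\big),$$ where $k$ ranges over a finite index set, $u_k\in\mathbb{C}$, $V_A^{(1)},V_A^{(3)}$ and all $(L_k)_A$ are unitaries on $A$, and $V_B^{(2)},V_B^{(4)}$ and all $(R_k)_B$ are unitaries on $B$. Then $$\gamma_{\mathrm{LO}}(U)\le\sum_k|u_k|^2+2\sum_{k\neq k'}|u_k|\,|u_{k'}| .$$ Furthermore, if $\mathrm{tr}(L_k^\dagger L_{k'})=0$ and $\mathrm{tr}(R_k^\dagger R_{k'})=0$ for all $k\ne k'$, then equality holds, and $$\gamma_{\mathrm{LO}}(U)=\gamma_{\mathrm{LOCC}}(U)=1+2\sum_{k\neq k'}|u_k|\,|u_{k'}| .$$ Here sums over $k\ne k'$ are over all ordered pairs of distinct indices.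
   Context: $\mathrm{CPTP}(X)$ is the set of completely positive trace-preserving maps on system $X$. Local operations: $\mathcal{N}(X)=\{\mathcal{A}^+-\mathcal{A}^-:\ \mathcal{A}^\pm \text{ completely positive},\ \mathcal{A}^++\mathcal{A}^-\in\mathrm{CPTP}(X)\}$ and $\mathrm{LO}(A,B)=\{\mathcal{F}_A\otimes\mathcal{F}_B:\ \mathcal{F}_A\in\mathcal{N}(A),\ \mathcal{F}_B\in\mathcal{N}(B)\}$. LOCC: an instrument is a finite family $(\mathcal{E}_i)$ of completely positive maps whose sum is trace preserving. A one-way local instrument from $A$ has the form $(\mathcal{E}_i\otimes\mathcal{T}_i)_i$ with $(\mathcal{E}_i)$ an instrument on $A$ and each $\mathcal{T}_i$ CPTP on $B$ (analogously from $B$). An LOCC instrument is obtained by finitely many rounds, in each of which a one-way local instrument (from $A$ or from $B$, possibly changing the local finite dimensions) is applied that may depend on all previous outcomes, followed by coarse-graining (summing) of outcomes. $\mathrm{LOCC}(A,B)$ is the set of maps $\sum_i s_i\mathcal{E}_i$ on $AB$ with $(\mathcal{E}_i)$ an LOCC instrument and $s_i\in\{+1,-1\}$. $\gamma$-factor: for a linear map $\mathcal{E}$ on $AB$ and $S\in\{\mathrm{LO}(A,B),\mathrm{LOCC}(A,B)\}$, $\gamma_S(\mathcal{E})=\min\{\sum_{i=1}^m|a_i| : \mathcal{E}=\sum_{i=1}^m a_i\mathcal{F}_i,\ m\ge1,\ \mathcal{F}_i\in S,\ a_i\in\mathbb{R}\}$. For a unitary $U$, $\gamma_S(U)$ means $\gamma_S$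 of the channel $\rho\mapsto U\rho U^\dagger$. *)

(* Defs.v *)
From HB Require Import structures.
From mathcomp Require Import all_boot all_order all_algebra.
From mathcomp Require Import reals.
From mathcomp.real_closed Require Import complex mxtens.

Set Implicit Arguments.
Unset Strict Implicit.
Unset Printing Implicit Defensive.

Import Order.TTheory GRing.Theory Num.Theory.
Local Open Scope ring_scope.
Local Open Scope complex_scope.
Local Open Scope sesquilinear_scope.

Section Maps.
Variable R : realType.
Local Notation C := R[i].

Definition superop (m n : nat) := 'Hom('M[C]_m, 'M[C]_n).

Definition unitary_channel n (U : 'M[C]_n) : superop n n :=
  linfun (fun X : 'M[C]_n => U *m X *m U ^t*).

(* The linear map that sends X *t Y to F X *t G Y, defined by linear extension
   from the matrix units E_ij *t E_kl (see tens_opE).  A bipartite system of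
   local dimensions a and b is carried by matrices of size a * b. *)
Definition tens_op a b a' b' (F : superop a a') (G : superop b b') :
    superop (a * b) (a' * b') :=
  linfun (fun X : 'M[C]_(a * b) => \sum_i \sum_j X i j *:
    (F (delta_mx (mxtens_unindex i).1 (mxtens_unindex j).1) *t
     G (delta_mx (mxtens_unindex i).2 (mxtens_unindex j).2))).

Definition psd n (X : 'M[C]_n) : Prop :=
  forall v : 'cV[C]_n, 0 <= (v ^t* *m X *m v) 0 0.

Definition completely_positive m n (E : superop m n) : Prop :=
  forall k (X : 'M[C]_(k * m)), psd X -> psd (tens_op (\1%VF : superop k k) E X).

Definition trace_preserving m n (E : superop m n) : Prop :=
  forall X : 'M[C]_m, \tr (E X) = \tr X.

Definition CPTP m n (E : superop m n) : Prop :=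
  completely_positive E /\ trace_preserving E.

Definition signed_local n (F : superop n n) : Prop :=
  exists Ap Am : superop n n,
    [/\ completely_positive Ap, completely_positive Am,
        CPTP (Ap + Am) & F = Ap - Am].

Definition LO a b (F : superop (a * b) (a * b)) : Prop :=
  exists FA FB,
    [/\ signed_local (n := a) FA, signed_local (n := b) FB & F = tens_op FA FB].

Definition instrument m n (I : finType) (E : I -> superop m n) : Prop :=
  (forall i, completely_positive (E i)) /\ trace_preserving (\sum_i E i).

Definition one_way_from_A a b a' b' (I : finType)
    (W : I -> superop (a * b) (a' * b')) : Prop :=
  exists (E : I -> superop a a') (T : I -> superop b b'),
    [/\ instrument E, forall i, CPTP (T i) & forall i, W i = tens_op (E i) (T i)].

Definition one_way_from_B a b a' b' (I : finType)
    (W : I -> superop (a * b) (a' * b')) : Prop :=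
  exists (T : I -> superop a a') (E : I -> superop b b'),
    [/\ forall i, CPTP (T i), instrument E & forall i, W i = tens_op (T i) (E i)].

(* Finite-round protocols as finitely branching trees: after the first round
   yields outcome i, the protocol P i is run.  Hence every later local
   instrument, its outcome set and its output dimensions may depend on the
   whole history of outcomes. *)
Inductive locc_protocol (a' b' : nat) : forall (a b : nat) (I : finType),
    (I -> superop (a * b) (a' * b')) -> Prop :=
| Locc_done :
    locc_protocol (fun _ : unit => (\1%VF : superop (a' * b') (a' * b')))
| Locc_round (a b a1 b1 : nat) (I : finType)
    (W : I -> superop (a * b) (a1 * b1)) (J : I -> finType)
    (P : forall i, J i -> superop (a1 * b1) (a' * b')) :
    one_way_from_A W \/ one_way_from_B W ->
    (forall i, locc_protocol (@P i)) ->
    locc_protocol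
      (fun ij : {i : I & J i} => (P (tag ij) (tagged ij) \o W (tag ij))%VF).

(* The map f relabels the outcomes; those with the same label are summed. *)
Definition locc_instrument a b (K : finType)
    (E : K -> superop (a * b) (a * b)) : Prop :=
  exists (I : finType) (P : I -> superop (a * b) (a * b)) (f : I -> K),
    locc_protocol P /\ forall k, E k = \sum_(i | f i == k) P i.

Definition LOCC a b (F : superop (a * b) (a * b)) : Prop :=
  exists (K : finType) (E : K -> superop (a * b) (a * b)) (s : K -> bool),
    locc_instrument E /\ F = \sum_k (-1) ^+ s k *: E k.

Definition decomposition_cost m n (S : superop m n -> Prop)
    (E : superop m n) (c : R) : Prop :=
  exists (l : nat) (t : 'I_l -> R) (F : 'I_l -> superop m n),
    [/\ (0 < l)%N, forall i, S (F i), E = \sum_i (t i)%:C *: F i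
      & c = \sum_i `|t i|].

(* g is the gamma-factor of E: the minimum of the decomposition costs exists
   and equals g. *)
Definition is_gamma m n (S : superop m n -> Prop) (E : superop m n) (g : R) :
    Prop :=
  decomposition_cost S E g /\ forall c, decomposition_cost S E c -> g <= c.

Lemma unitary_channelE n (U X : 'M[C]_n) :
  unitary_channel U X = U *m X *m U ^t*.
Proof.
suff lin : linear (fun X : 'M[C]_n => U *m X *m U ^t*).
  pose aux := GRing.isLinear.Build _ _ _ _ _ lin.
  pose g : {linear _ -> _} := HB.pack (fun X : 'M[C]_n => U *m X *m U ^t*) aux.
  exact: (lfunE g X).
by move=> c Y Z /=; rewrite mulmxDr mulmxDl -scalemxAr -scalemxAl.
Qed.

Lemma tens_opE a b a' b' (F : superop a a') (G : superop b b')
    (X : 'M[C]_a) (Y : 'M[C]_b) : tens_op F G (X *t Y) = F X *t G Y.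
Proof.
pose f (Z : 'M[C]_(a * b)) := \sum_i \sum_j Z i j *:
  (F (delta_mx (mxtens_unindex i).1 (mxtens_unindex j).1) *t
   G (delta_mx (mxtens_unindex i).2 (mxtens_unindex j).2)).
have lin : linear f.
  move=> c Z1 Z2; rewrite /f scaler_sumr -big_split; apply: eq_bigr => i _.
  rewrite scaler_sumr -big_split; apply: eq_bigr => j _ /=.
  by rewrite !mxE scalerDl scalerA.
pose aux := GRing.isLinear.Build _ _ _ _ _ lin.
pose g : {linear _ -> _} := HB.pack f aux.
have big_tens (V : zmodType) (h : 'I_(a * b) -> V) :
    \sum_i h i = \sum_i \sum_k h (mxtens_index (i, k)).
  rewrite pair_bigA (reindex (fun ik : 'I_a * 'I_b => mxtens_index ik)) /=.
    by apply: eq_bigr => -[].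
  by exists (@mxtens_unindex a b) => x _; rewrite ?mxtens_indexK ?mxtens_unindexK.
have fE : f (X *t Y) = \sum_i \sum_k \sum_j \sum_l
    (X i j * Y k l) *: (F (delta_mx i j) *t G (delta_mx k l)).
  rewrite /f big_tens; apply: eq_bigr => i _; apply: eq_bigr => k _.
  rewrite big_tens; apply: eq_bigr => j _; apply: eq_bigr => l _.
  by rewrite !mxtens_indexK tensmxE.
rewrite (lfunE g (X *t Y)) [LHS]fE.
apply/matrixP => p q; rewrite [in RHS](matrix_sum_delta X) [in RHS](matrix_sum_delta Y).
rewrite !linear_sum !mxE !summxE big_distrl; apply: eq_bigr => i _.
rewrite summxE big_distrr; apply: eq_bigr => k _.
rewrite !linear_sum !summxE big_distrl; apply: eq_bigr => j _.
rewrite summxE big_distrr; apply: eq_bigr => l _.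
by rewrite !linearZ /= !mxE mulrACA.
Qed.

End Maps.

(* Main.v *)
From HB Require Import structures.
Require Import Defs.
From mathcomp Require Import all_boot all_order all_algebra.
From mathcomp Require Import boolp classical_sets filter.
From mathcomp Require Import reals ring lra.
From mathcomp Require Import topology normedtype sequences.
From mathcomp.real_closed Require Import complex mxtens.

(* Write [U = sum_k u_k (L_k (x) R_k)], the outer local unitaries being absorbed
   into L_k and R_k.  Expanding [U . U^*] gives diagonal terms, which are local
   channels with weights |u_k|^2, and cross terms; a cross term plus its adjoint
   is twice a difference of two elements of LO, by
     Re (z A (x) B) = Re (z A) (x) Re B - Im (z A) (x) Im B
   with A = L_k . L_k'^* and B = R_k . R_k'^*.  This gives the upper bound.

   For the lower bound, put [M = sum_k (u_k / |u_k|) (L_k (x) R_k)] and let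
   [w F] be the expectation of the Choi matrix of F in the vector of M.  LOCC
   branches are sums of maps [(A (x) B) . (A (x) B)^*], on which
   [0 <= w F <= ab tr (F 1)] by the inequalities of Bessel and Cauchy-Schwarz.
   Hence [2 w F - ab tr (F 1)] has absolute value at most [(ab)^2] on LOCC,
   whereas on [U . U^*] it equals [(ab)^2 (2 (sum_k |u_k|)^2 - 1)].

   The minimum over LO is attained: by Caratheodory the number of terms can be
   bounded, and a minimizing sequence of decompositions has a limit along an
   ultrafilter because signed local operations have bounded entries. *)

Set Implicit Arguments.
Unset Strict Implicit.
Unset Printing Implicit Defensive.

Import Order.TTheory GRing.Theory Num.Theory.
Import ComplexField.Normc.
Local Open Scope complex_scope.
Local Open Scope ring_scope.
Local Open Scope sesquilinear_scope.

(** * Tensor products of superoperators *)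

Lemma scale_half_double (F : numFieldType) (V : lmodType F) (v : V) :
  2^-1 *: (v + v) = v.
Proof.
by rewrite -mulr2n -[v *+ 2]scaler_nat scalerA mulVf ?pnatr_eq0 // scale1r.
Qed.

(* Otherwise unification unfolds superoperators down to matrices. *)
Opaque tens_op.

Section Tensor.
Variable R : realType.
Local Notation C := R[i].

Lemma adjmxM m n p (A : 'M[C]_(m, n)) (B : 'M_(n, p)) :
  (A *m B)^t* = B^t* *m A^t*.
Proof. by rewrite trmx_mul map_mxM. Qed.

Lemma adjmx_tens m n p q (A : 'M[C]_(m, n)) (B : 'M_(p, q)) :
  (A *t B)^t* = A^t* *t B^t*.
Proof. by rewrite trmx_tens map_mxT. Qed.

Lemma adjmxD m n (A B : 'M[C]_(m, n)) : (A + B)^t* = A^t* + B^t*.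
Proof. by rewrite raddfD /= map_mxD. Qed.

Lemma adjmxN m n (A : 'M[C]_(m, n)) : (- A)^t* = - A^t*.
Proof. by rewrite raddfN /= map_mxN. Qed.

Lemma adjmxZ m n c (A : 'M[C]_(m, n)) : (c *: A)^t* = c^* *: A^t*.
Proof. by rewrite linearZ /= map_mxZ. Qed.

Lemma adjmx_sum m n (I : finType) (P : pred I) (A : I -> 'M[C]_(m, n)) :
  (\sum_(i | P i) A i)^t* = \sum_(i | P i) (A i)^t*.
Proof. by rewrite linear_sum /= map_mx_sum. Qed.

Lemma adjmx1 n : (1%:M : 'M[C]_n)^t* = 1%:M.
Proof. by rewrite trmx1 map_mx1. Qed.

Lemma trmx_adjmx m n (A : 'M[C]_(m, n)) : \tr (A *m A^t*) = \sum_i \sum_j `|A i j| ^+ 2.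
Proof.
apply: eq_bigr => i _; rewrite mxE; apply: eq_bigr => j _.
by rewrite !mxE normCK.
Qed.

Lemma tensmxDl m n p q (A B : 'M[C]_(m, n)) (D : 'M[C]_(p, q)) :
  (A + B) *t D = A *t D + B *t D.
Proof. by apply/matrixP => i j; rewrite !mxE mulrDl. Qed.

Lemma tensmxDr m n p q (A B : 'M[C]_(m, n)) (D : 'M[C]_(p, q)) :
  D *t (A + B) = D *t A + D *t B.
Proof. by apply/matrixP => i j; rewrite !mxE mulrDr. Qed.

Lemma tensmxZl m n p q c (A : 'M[C]_(m, n)) (D : 'M[C]_(p, q)) :
  (c *: A) *t D = c *: (A *t D).
Proof. by apply/matrixP => i j; rewrite !mxE mulrA. Qed.

Lemma tensmxZr m n p q c (A : 'M[C]_(m, n)) (D : 'M[C]_(p, q)) :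
  D *t (c *: A) = c *: (D *t A).
Proof. by apply/matrixP => i j; rewrite !mxE mulrCA. Qed.

Lemma tensmx11 a b : (1%:M : 'M[C]_a) *t (1%:M : 'M[C]_b) = 1%:M.
Proof.
apply/matrixP => i j; case: (mxtens_indexP i) => i1 i2.
case: (mxtens_indexP j) => j1 j2.
rewrite tensmxE !mxE (can_eq (@mxtens_indexK a b)) xpair_eqE.
by case: (i1 == j1); case: (i2 == j2); rewrite ?mulr1 ?mulr0 ?mul0r.
Qed.

Lemma mxtens_sum (V : nmodType) a b (h : 'I_(a * b) -> V) :
  \sum_i h i = \sum_i \sum_k h (mxtens_index (i, k)).
Proof.
rewrite pair_bigA (reindex (fun ik : 'I_a * 'I_b => mxtens_index ik)) /=.
  by apply: eq_bigr => -[].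
by exists (@mxtens_unindex a b) => x _; rewrite ?mxtens_indexK ?mxtens_unindexK.
Qed.

Lemma mxtrace_tens a b (X : 'M[C]_a) (Y : 'M[C]_b) : \tr (X *t Y) = \tr X * \tr Y.
Proof.
rewrite [LHS]mxtens_sum mulr_suml; apply: eq_bigr => i _.
by rewrite mulr_sumr; apply: eq_bigr => k _; rewrite tensmxE.
Qed.

Lemma tens_delta a b (i j : 'I_a) (k l : 'I_b) :
  delta_mx i j *t delta_mx k l =
  delta_mx (mxtens_index (i, k)) (mxtens_index (j, l)) :> 'M[C]_(a * b).
Proof.
apply/matrixP => p q; case: (mxtens_indexP p) => p1 p2.
case: (mxtens_indexP q) => q1 q2.
rewrite tensmxE !mxE !(can_eq (@mxtens_indexK a b)) !xpair_eqE -natrM mulnb.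
by rewrite andbACA.
Qed.

Lemma delta_mx_tens a b (i j : 'I_(a * b)) :
  delta_mx i j =
  delta_mx (mxtens_unindex i).1 (mxtens_unindex j).1 *t
  delta_mx (mxtens_unindex i).2 (mxtens_unindex j).2 :> 'M[C]_(a * b).
Proof. by rewrite tens_delta -!surjective_pairing !mxtens_unindexK. Qed.

(** Matrix units of the composite system are product matrices, so products span. Identities between
    superoperators are checked on them without unfolding [tens_op]. *)
Lemma superop_tens_eq a b (V : vectType C) (f g : 'Hom('M[C]_(a * b), V)) :
  (forall X Y, f (X *t Y) = g (X *t Y)) -> f = g.
Proof.
move=> fg; apply/lfunP => X; rewrite [X]matrix_sum_delta !linear_sum.
apply: eq_bigr => i _; rewrite !linear_sum; apply: eq_bigr => j _.
by rewrite !linearZ /= delta_mx_tens fg.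
Qed.

(** Recovers the defining sum from [tens_opE]. It shows the entries of [tens_op F G X] to be sums of
    products of entries of [F] and [G], as needed for limits. *)
Lemma tens_op_entry a b a' b' (F : superop R a a') (G : superop R b b') X :
  tens_op F G X = \sum_i \sum_j X i j *:
    (F (delta_mx (mxtens_unindex i).1 (mxtens_unindex j).1) *t
     G (delta_mx (mxtens_unindex i).2 (mxtens_unindex j).2)).
Proof.
rewrite {1}[X]matrix_sum_delta !linear_sum; apply: eq_bigr => i _.
rewrite !linear_sum; apply: eq_bigr => j _; rewrite !linearZ /=.
by rewrite delta_mx_tens tens_opE.
Qed.

Lemma tens_opDl a b a' b' (F F' : superop R a a') (G : superop R b b') :
  tens_op (F + F') G = tens_op F G + tens_op F' G.
Proof.
by apply: superop_tens_eq => X Y; rewrite !(add_lfunE, tens_opE) -tensmxDl.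
Qed.

Lemma tens_opDr a b a' b' (F : superop R a a') (G G' : superop R b b') :
  tens_op F (G + G') = tens_op F G + tens_op F G'.
Proof.
by apply: superop_tens_eq => X Y; rewrite !(add_lfunE, tens_opE) -tensmxDr.
Qed.

Lemma tens_opZl a b a' b' c (F : superop R a a') (G : superop R b b') :
  tens_op (c *: F) G = c *: tens_op F G.
Proof.
by apply: superop_tens_eq => X Y; rewrite !(scale_lfunE, tens_opE) -tensmxZl.
Qed.

Lemma tens_opZr a b a' b' c (F : superop R a a') (G : superop R b b') :
  tens_op F (c *: G) = c *: tens_op F G.
Proof.
by apply: superop_tens_eq => X Y; rewrite !(scale_lfunE, tens_opE) -tensmxZr.
Qed.

Lemma tens_opNl a b a' b' (F : superop R a a') (G : superop R b b') :
  tens_op (- F) G = - tens_op F G.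
Proof. by rewrite -[- F]scaleN1r tens_opZl scaleN1r. Qed.

Lemma tens_opNr a b a' b' (F : superop R a a') (G : superop R b b') :
  tens_op F (- G) = - tens_op F G.
Proof. by rewrite -[- G]scaleN1r tens_opZr scaleN1r. Qed.

Lemma tens_op_suml a b a' b' (I : finType) (F : I -> superop R a a')
  (G : superop R b b') : tens_op (\sum_i F i) G = \sum_i tens_op (F i) G.
Proof.
apply: (big_morph (fun F => tens_op F G)) => [F1 F2|]; first exact: tens_opDl.
by rewrite -(scale0r (0 : superop R a a')) tens_opZl scale0r.
Qed.

Lemma tens_op_sumr a b a' b' (I : finType) (F : superop R a a')
  (G : I -> superop R b b') : tens_op F (\sum_i G i) = \sum_i tens_op F (G i).
Proof.
apply: (big_morph (tens_op F)) => [G1 G2|]; first exact: tens_opDr.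
by rewrite -(scale0r (0 : superop R b b')) tens_opZr scale0r.
Qed.

(** Equal arguments give a Kraus term, distinct ones the cross terms in the expansion of U . U^*. *)
Definition two_sided m n (K L : 'M[C]_(n, m)) : superop R m n :=
  linfun (mulmxr (L^t*) \o mulmx K).

Lemma two_sidedE m n (K L : 'M[C]_(n, m)) X : two_sided K L X = K *m X *m L^t*.
Proof. by rewrite lfunE. Qed.

Lemma unitary_channel_two_sided n (U : 'M[C]_n) : unitary_channel U = two_sided U U.
Proof.
apply/lfunP => X.
exact: etrans (unitary_channelE _ _) (esym (two_sidedE _ _ _)).
Qed.

Opaque two_sided.

Lemma two_sidedDl m n (K K' L : 'M[C]_(n, m)) :
  two_sided (K + K') L = two_sided K L + two_sided K' L.
Proof. by apply/lfunP => X; rewrite add_lfunE !two_sidedE !mulmxDl. Qed.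

Lemma two_sidedDr m n (K L L' : 'M[C]_(n, m)) :
  two_sided K (L + L') = two_sided K L + two_sided K L'.
Proof. by apply/lfunP => X; rewrite add_lfunE !two_sidedE adjmxD mulmxDr. Qed.

Lemma two_sidedZl m n c (K L : 'M[C]_(n, m)) :
  two_sided (c *: K) L = c *: two_sided K L.
Proof. by apply/lfunP => X; rewrite scale_lfunE !two_sidedE -!scalemxAl. Qed.

Lemma two_sidedZr m n c (K L : 'M[C]_(n, m)) :
  two_sided K (c *: L) = c^* *: two_sided K L.
Proof. by apply/lfunP => X; rewrite scale_lfunE !two_sidedE adjmxZ -scalemxAr. Qed.

Lemma two_sided_suml m n (I : finType) (P : pred I) (K : I -> 'M[C]_(n, m)) L :
  two_sided (\sum_(i | P i) K i) L = \sum_(i | P i) two_sided (K i) L.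
Proof.
apply/lfunP => X; rewrite sum_lfunE two_sidedE !mulmx_suml.
by apply: eq_bigr => i _; rewrite two_sidedE.
Qed.

Lemma two_sided_sumr m n (I : finType) (P : pred I) (K : I -> 'M[C]_(n, m)) L :
  two_sided L (\sum_(i | P i) K i) = \sum_(i | P i) two_sided L (K i).
Proof.
apply/lfunP => X; rewrite sum_lfunE two_sidedE adjmx_sum mulmx_sumr.
by apply: eq_bigr => i _; rewrite two_sidedE.
Qed.

Lemma tens_op_two_sided a b a' b' (K L : 'M[C]_(a', a)) (K' L' : 'M[C]_(b', b)) :
  tens_op (two_sided K L) (two_sided K' L') = two_sided (K *t K') (L *t L').
Proof.
apply: superop_tens_eq => X Y.
by rewrite tens_opE !two_sidedE adjmx_tens !tensmx_mul.
Qed.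

Lemma two_sided1 n : two_sided 1%:M 1%:M = \1%VF :> superop R n n.
Proof.
by apply/lfunP => X; rewrite two_sidedE adjmx1 mulmx1 mul1mx id_lfunE.
Qed.

Lemma two_sided_comp m n p (K L : 'M[C]_(n, m)) (K' L' : 'M[C]_(p, n)) :
  (two_sided K' L' \o two_sided K L)%VF = two_sided (K' *m K) (L' *m L).
Proof.
by apply/lfunP => X; rewrite comp_lfunE !two_sidedE adjmxM !mulmxA.
Qed.
End Tensor.

(** * Kraus decompositions *)

Section CompletelyPositive.
Variable R : realType.
Local Notation C := R[i].

Lemma psd_gram n p (A : 'M[C]_(n, p)) : psd (A *m A^t*).
Proof.
move=> v; have -> : v^t* *m (A *m A^t*) *m v = (v^t* *m A) *m (v^t* *m A)^t*.
  by rewrite adjmxM trmxCK !mulmxA.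
by rewrite mxE sumr_ge0 // => i _; rewrite !mxE -normCK exprn_ge0.
Qed.

Lemma psd_conj n p (K : 'M[C]_(p, n)) X : psd X -> psd (K *m X *m K^t*).
Proof.
move=> Xpsd v; have := Xpsd (K^t* *m v).
by rewrite adjmxM trmxCK !mulmxA.
Qed.

Lemma psdD n (X Y : 'M[C]_n) : psd X -> psd Y -> psd (X + Y).
Proof.
by move=> Xpsd Ypsd v; rewrite mulmxDr mulmxDl mxE addr_ge0 ?Xpsd ?Ypsd.
Qed.

Lemma psdZ n (c : C) (X : 'M[C]_n) : 0 <= c -> psd X -> psd (c *: X).
Proof.
by move=> c0 Xpsd v; rewrite -scalemxAr -scalemxAl mxE mulr_ge0 ?Xpsd.
Qed.

Lemma cp_two_sided m n (K : 'M[C]_(n, m)) : completely_positive (two_sided K K).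
Proof.
move=> k X Xpsd; rewrite -two_sided1 tens_op_two_sided two_sidedE.
exact: psd_conj.
Qed.

Lemma cpD m n (E F : superop R m n) :
  completely_positive E -> completely_positive F -> completely_positive (E + F).
Proof.
by move=> Ecp Fcp k X Xpsd; rewrite tens_opDr add_lfunE; apply: psdD; auto.
Qed.

Lemma cpZ m n (c : C) (E : superop R m n) : 0 <= c ->
  completely_positive E -> completely_positive (c *: E).
Proof.
by move=> c0 Ecp k X Xpsd; rewrite tens_opZr scale_lfunE; apply: psdZ; auto.
Qed.

Lemma psd_quad n (X : 'M[C]_n) i j z : psd X ->
  0 <= X i i + z * X i j + z^* * X j i + z^* * z * X j j.
Proof.
move=> /(_ (delta_mx i 0 + z *: delta_mx j 0)).
rewrite adjmxD adjmxZ !trmx_delta !map_delta_mx !(mulmxDl, mulmxDr).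
rewrite -!(scalemxAl, scalemxAr) -!rowE -!colE scalerA !mxE.
by rewrite !addrA -!(addrAC _ (z^* * X j i)).
Qed.

Lemma psd_diag_ge0 n (X : 'M[C]_n) i : psd X -> 0 <= X i i.
Proof.
by move=> /(@psd_quad _ _ i i 0); rewrite rmorph0 !mul0r !addr0.
Qed.

(** Positivity in the order of the complex numbers includes being real. Reality of the form on e_i +
    z e_j at z = 1 and z = 'i makes X_ij + X_ji and 'i (X_ij - X_ji) real, so X_ij is the conjugate
    of X_ji. *)
Lemma psd_hermitian n (X : 'M[C]_n) : psd X -> X = X^t*.
Proof.
move=> Xpsd; apply/matrixP => i j; rewrite !mxE.
have q z := CrealP (ger0_real (psd_quad i j z Xpsd)).
have d k := CrealP (ger0_real (psd_diag_ge0 k Xpsd)).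
have e1 := q 1; have e2 := q 'i; move: e1 e2.
rewrite !(rmorphD, rmorphM) /= !conjCK !d rmorph1 conjCi !mul1r.
set x := X i j; set y := X j i => e1 e2.
have {}e2 : 'i * 'i * (x - y + x^* - y^*) = 0.
  have -> : 'i * 'i * (x - y + x^* - y^*) =
    'i * ((X i i + 'i * x + - 'i * y + - 'i * 'i * X j j) -
          (X i i + - 'i * x^* + 'i * y^* + 'i * - 'i * X j j)) by ring.
  by rewrite e2 subrr mulr0.
rewrite -expr2 sqrCi mulN1r in e2.
apply/eqP; rewrite -subr_eq0 -(mulrI_eq0 _ (mulfI (_ : 2 != 0))) ?pnatr_eq0 //.
have -> : 2 * (x - y^*) = (X i i + x + y + X j j) -
  (X i i + x^* + y^* + X j j) - - (x - y + x^* - y^*) by ring.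
by rewrite e1 e2 !subrr.
Qed.

(** By the spectral theorem X = P^* D P. The eigenvalues are diagonal entries of the positive matrix
    P X P^*, so D has a square root and S = P^* sqrt D works. *)
Lemma psd_gramP n (X : 'M[C]_n) : psd X -> exists S : 'M[C]_n, X = S *m S^t*.
Proof.
move=> Xpsd.
have /hermitian_normalmx/orthomx_spectralP : X \is hermsymmx.
  by rewrite qualifE expr0 scale1r -psd_hermitian.
set P := spectralmx X; set d := spectral_diag X => eX.
have Pu : P \is unitarymx := spectral_unitarymx X.
have PP : P *m P^t* = 1%:M by apply/unitarymxP.
rewrite invmx_unitary // in eX.
have d_ge0 i : 0 <= d 0 i.
  have : psd (P *m X *m P^t*) by apply: psd_conj.
  move=> /(@psd_diag_ge0 _ _ i); rewrite eX !mulmxA PP mul1mx -!mulmxA PP mulmx1.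
  by rewrite mxE eqxx.
exists (P^t* *m diag_mx (map_mx sqrtC d)).
rewrite adjmxM trmxCK -mulmxA (mulmxA _ _ P) [LHS]eX -mulmxA.
congr (_ *m (_ *m _)); rewrite tr_diag_mx map_diag_mx mulmx_diag.
congr diag_mx; apply/rowP => i; rewrite !mxE.
by rewrite -normCK ger0_norm ?sqrtC_ge0 ?sqrtCK.
Qed.

Lemma mulmx_deltaE m n (K L : 'M[C]_(n, m)) i j k l :
  (K *m delta_mx i j *m L^t*) k l = K k i * (L l j)^*.
Proof.
rewrite -(mul_delta_mx (0 : 'I_1)) mulmxA -colE -mulmxA -rowE.
by rewrite mxE big_ord1 !mxE.
Qed.

(** Choi's argument: with an ancilla of dimension m, complete positivity turns w w^* into a positive
    Choi matrix S S^*. Each column of S, reshaped to an n by m matrix, is a Kraus operator. *)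
Lemma kraus m n (E : superop R m n) : completely_positive E ->
  exists r (K : 'I_r -> 'M[C]_(n, m)), E = \sum_i two_sided (K i) (K i).
Proof.
move=> Ecp.
(* The unnormalised maximally entangled vector; it has [1 * 1] columns because it sums tensor
   products of column vectors. *)
pose w : 'M[C]_(m * m, 1 * 1) := \sum_i (delta_mx i 0 : 'cV_m) *t (delta_mx i 0 : 'cV_m).
have ww : w *m w^t* = \sum_i \sum_j delta_mx i j *t delta_mx i j.
  rewrite adjmx_sum mulmx_suml; apply: eq_bigr => i _.
  rewrite mulmx_sumr; apply: eq_bigr => j _.
  by rewrite adjmx_tens tensmx_mul !trmx_delta !map_delta_mx !mul_delta_mx.
have /psd_gramP[S eS] := Ecp m _ (psd_gram w).
have SE i j k l : E (delta_mx i j) k l =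
    \sum_r S (mxtens_index (i, k)) r * (S (mxtens_index (j, l)) r)^*.
  have : (S *m S^t*) (mxtens_index (i, k)) (mxtens_index (j, l)) = E (delta_mx i j) k l.
    rewrite -eS ww linear_sum summxE (bigD1 i) //= linear_sum summxE (bigD1 j) //=.
    rewrite tens_opE id_lfunE tensmxE mxE !eqxx mul1r.
    rewrite [X in _ + X]big1 ?addr0 => [|i1 ni1]; last first.
      rewrite linear_sum summxE big1 // => j1 _.
      by rewrite /= tens_opE id_lfunE tensmxE mxE eq_sym (negPf ni1) mul0r.
    rewrite big1 ?addr0 // => j1 nj1.
    by rewrite /= tens_opE id_lfunE tensmxE mxE (eq_sym j) (negPf nj1) andbF mul0r.
  by move=> <-; rewrite mxE; apply: eq_bigr => r _; rewrite !mxE.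
exists (m * n)%N, (fun r => \matrix_(k, i) S (mxtens_index (i, k)) r).
apply/lfunP => X; rewrite [X]matrix_sum_delta !linear_sum; apply: eq_bigr => i _.
rewrite !linear_sum; apply: eq_bigr => j _; rewrite !linearZ; congr (_ *: _).
apply/matrixP => k l; rewrite SE /= sum_lfunE summxE; apply: eq_bigr => r _.
by rewrite two_sidedE mulmx_deltaE !mxE.
Qed.
End CompletelyPositive.

(** * LOCC branches are separable *)

Section Separable.
Variable R : realType.
Local Notation C := R[i].

(** Finite sums of product Kraus terms, without an index type: closure under addition and
    composition is then proved by induction. *)
Inductive separable a b a' b' : superop R (a * b) (a' * b') -> Prop :=
| Sep_zero : separable 0
| Sep_add (A : 'M[C]_(a', a)) (B : 'M[C]_(b', b)) F :
    separable F -> separable (two_sided (A *t B) (A *t B) + F).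

Lemma separableD a b a' b' (F G : superop R (a * b) (a' * b')) :
  separable F -> separable G -> separable (F + G).
Proof.
by move=> Fsep Gsep; elim: Fsep => [|A B {}F _ IH];
  rewrite ?add0r // -addrA; constructor.
Qed.

Lemma separable_sum a b a' b' (I : finType) (P : pred I)
    (F : I -> superop R (a * b) (a' * b')) :
  (forall i, separable (F i)) -> separable (\sum_(i | P i) F i).
Proof.
by move=> Fsep; apply: (big_ind (@separable a b a' b'));
  [constructor | exact: separableD |].
Qed.

Lemma separable_two_sided a b a' b' (A : 'M[C]_(a', a)) (B : 'M[C]_(b', b)) :
  separable (two_sided (A *t B) (A *t B)).
Proof. by rewrite -[two_sided _ _]addr0; do 2 constructor. Qed.

Lemma separable_comp a b a1 b1 a2 b2 (F : superop R (a * b) (a1 * b1))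
    (G : superop R (a1 * b1) (a2 * b2)) :
  separable F -> separable G -> separable (G \o F)%VF.
Proof.
move=> Fsep Gsep; elim: Fsep => [|A B {}F _ IH].
  by rewrite comp_lfun0r; constructor.
rewrite comp_lfunDr; apply: separableD => {IH} //.
elim: Gsep => [|A' B' {}G _ IH]; first by rewrite comp_lfun0l; constructor.
rewrite comp_lfunDl two_sided_comp tensmx_mul.
by constructor.
Qed.

Lemma separable_tens_op a b a' b' (E : superop R a a') (T : superop R b b') :
  completely_positive E -> completely_positive T -> separable (tens_op E T).
Proof.
move=> /kraus[r [A ->]] /kraus[s [B ->]].
rewrite tens_op_suml; apply: separable_sum => i.
rewrite tens_op_sumr; apply: separable_sum => j.
by rewrite tens_op_two_sided; apply: separable_two_sided.
Qed.

(** Traces are compared on matrix units, where they factor: each [T i] preserves the trace of the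
    second factor, and what remains is the sum over outcomes on the first. *)
Lemma trace_preserving_tens_op a b a' b' (I : finType) (E : I -> superop R a a')
    (T : I -> superop R b b') :
  trace_preserving (\sum_i E i) -> (forall i, trace_preserving (T i)) ->
  trace_preserving (\sum_i tens_op (E i) (T i)).
Proof.
move=> Etp Ttp X; rewrite [X]matrix_sum_delta !linear_sum; apply: eq_bigr => i _.
rewrite !linear_sum; apply: eq_bigr => j _; rewrite !linearZ; congr (_ * _).
rewrite delta_mx_tens /= sum_lfunE linear_sum mxtrace_tens -Etp sum_lfunE.
rewrite linear_sum mulr_suml; apply: eq_bigr => k _.
by rewrite /= tens_opE mxtrace_tens Ttp.
Qed.

Lemma trace_preserving_tens_op_sym a b a' b' (I : finType)
    (E : I -> superop R a a') (T : I -> superop R b b') :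
  (forall i, trace_preserving (E i)) -> trace_preserving (\sum_i T i) ->
  trace_preserving (\sum_i tens_op (E i) (T i)).
Proof.
move=> Etp Ttp X; rewrite [X]matrix_sum_delta !linear_sum; apply: eq_bigr => i _.
rewrite !linear_sum; apply: eq_bigr => j _; rewrite !linearZ; congr (_ * _).
rewrite delta_mx_tens /= sum_lfunE linear_sum mxtrace_tens -Ttp sum_lfunE.
rewrite linear_sum mulr_sumr; apply: eq_bigr => k _.
by rewrite /= tens_opE mxtrace_tens Etp.
Qed.

Lemma one_way_separable a b a' b' (I : finType)
    (W : I -> superop R (a * b) (a' * b')) :
  one_way_from_A W \/ one_way_from_B W ->
  (forall i, separable (W i)) /\ trace_preserving (\sum_i W i).
Proof.
case=> -[E [T [Ei Ti Wi]]]; 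
  (split=> [i|]; [rewrite Wi|rewrite (eq_bigr _ (fun i _ => Wi i))]).
- by apply: separable_tens_op; [case: Ei | case: (Ti i)].
- by apply: trace_preserving_tens_op => [|i]; [case: Ei | case: (Ti i)].
- by apply: separable_tens_op; [case: (Ei i) | case: Ti].
- by apply: trace_preserving_tens_op_sym => [i|]; [case: (Ei i) | case: Ti].
Qed.

(** Induction on the protocol tree. Summing over the continuations of an outcome [i] leaves the
    trace of [W i], and summing over [i] then leaves the trace of the input. *)
Lemma locc_protocol_separable a b a' b' (I : finType)
    (P : I -> superop R (a * b) (a' * b')) :
  locc_protocol P ->
  (forall i, separable (P i)) /\ trace_preserving (\sum_i P i).
Proof.
elim=> [|{}a {}b a1 b1 {}I W J {}P /one_way_separable[Wsep Wtp] _ IH].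
  split=> [_|X]; last by rewrite big_const card_unit /= addr0 id_lfunE.
  by rewrite -two_sided1 -tensmx11; apply: separable_two_sided.
split=> [[i j]|X] /=; first by apply: separable_comp => //; case: (IH i).
rewrite -Wtp !sum_lfunE !linear_sum.
rewrite -(sig_big_dep xpredT (fun _ _ => true) (fun i j => \tr ((P i j \o W i)%VF X))) /=.
apply: eq_bigr => i _; have [_ <-] := IH i.
by rewrite sum_lfunE linear_sum; apply: eq_bigr => j _; rewrite comp_lfunE.
Qed.

End Separable.

(** * The entanglement witness *)

Section Witness.
Variable R : realType.
Local Notation C := R[i].

(** The triangle inequality reduces to absolute values, for which Lagrange's identity writes twice
    the deficit as a sum of squares. *)
Lemma sum_norm_cauchy_schwarz (K : finType) (x y : K -> C) :
  `|\sum_k x k * y k| ^+ 2 <= (\sum_k `|x k| ^+ 2) * (\sum_k `|y k| ^+ 2).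
Proof.
apply: (@le_trans _ _ ((\sum_k `|x k| * `|y k|) ^+ 2)).
  rewrite lerXn2r ?nnegrE ?sumr_ge0 // => [k _|]; first by rewrite mulr_ge0.
  by apply: le_trans (ler_norm_sum _ _ _) _; rewrite ler_sum // => k _; rewrite normrM.
have : 0 <= \sum_k \sum_l (`|x k| * `|y l| - `|x l| * `|y k|) ^+ 2.
  apply: sumr_ge0 => k _; apply: sumr_ge0 => l _.
  by rewrite real_exprn_even_ge0 // rpredB // rpredM ?normr_real.
have -> : \sum_k \sum_l (`|x k| * `|y l| - `|x l| * `|y k|) ^+ 2 =
    2 * ((\sum_k `|x k| ^+ 2) * (\sum_k `|y k| ^+ 2) - (\sum_k `|x k| * `|y k|) ^+ 2).
  have sq k l : (`|x k| * `|y l| - `|x l| * `|y k|) ^+ 2 = (`|x k| * `|y l|) ^+ 2 +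
      (`|x l| * `|y k|) ^+ 2 - 2 * (`|x k| * `|y l| * (`|x l| * `|y k|)) by ring.
  under eq_bigr do under eq_bigr do rewrite sq.
  under eq_bigr do rewrite sumrB big_split /= -mulr_sumr.
  rewrite sumrB big_split /= -mulr_sumr [X in _ + X - _]exchange_big /=.
  have -> : (\sum_k `|x k| ^+ 2) * (\sum_k `|y k| ^+ 2) =
      \sum_k \sum_l (`|x k| * `|y l|) ^+ 2.
    rewrite mulr_suml; apply: eq_bigr => k _; rewrite mulr_sumr.
    by apply: eq_bigr => l _; rewrite exprMn.
  have -> : (\sum_k `|x k| * `|y k|) ^+ 2 =
      \sum_k \sum_l `|x k| * `|y l| * (`|x l| * `|y k|).
    rewrite expr2 mulr_suml; apply: eq_bigr => k _; rewrite mulr_sumr.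
    by apply: eq_bigr => l _; ring.
  by ring.
by rewrite pmulr_rge0 ?ltr0n // subr_ge0.
Qed.

Lemma mxtrace_sum n (I : finType) (P : pred I) (A : I -> 'M[C]_n) :
  \tr (\sum_(i | P i) A i) = \sum_(i | P i) \tr (A i).
Proof. exact: linear_sum. Qed.

Lemma hilbert_schmidt_bessel n (K : finType) (L : K -> 'M[C]_n) (A : 'M[C]_n) :
  (forall k, L k \is unitarymx) ->
  (forall k k', k != k' -> \tr ((L k)^t* *m L k') = 0) ->
  \sum_k `|\tr ((L k)^t* *m A)| ^+ 2 <= n%:R * \tr (A *m A^t*).
Proof.
(* In dimension zero both sides vanish; otherwise a factor [n.+1] is cancelled at the end. *)
case: n L A => [|n] L A Lu Lo.
  by rewrite mul0r big1 // => k _; rewrite [\tr _]big_ord0 normr0 expr0n.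
set c := fun k => \tr ((L k)^t* *m A).
pose D := n.+1%:R *: A - \sum_k c k *: L k.
have Ltr k k' : \tr ((L k)^t* *m L k') = n.+1%:R *+ (k == k').
  have [<-|/Lo->//] := eqVneq k k'; rewrite mulr1n.
  by have /unitarymxP/mulmx1C-> := Lu k; rewrite mxtrace1.
have trC k : \tr (A *m (L k)^t*) = c k.
  by rewrite mxtrace_mulC.
have trJ (X : 'M[C]_n.+1) : \tr (X^t*) = (\tr X)^*.
  by rewrite rmorph_sum; apply: eq_bigr => i _; rewrite !mxE.
have trC' k : \tr (L k *m A^t*) = (c k)^*.
  by rewrite -trC -trJ adjmxM trmxCK.
have : 0 <= \tr (D *m D^t*).
  by rewrite trmx_adjmx; apply: sumr_ge0 => i _; apply: sumr_ge0 => j _; rewrite exprn_ge0.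
have DA : \tr (D *m A^t*) = n.+1%:R * \tr (A *m A^t*) - \sum_k `|c k| ^+ 2.
  rewrite mulmxBl -scalemxAl raddfB /= mxtraceZ mulmx_suml mxtrace_sum; congr (_ - _).
  by apply: eq_bigr => k _; rewrite -scalemxAl /= mxtraceZ trC' normCK.
have DL k : \tr (D *m (L k)^t*) = 0.
  rewrite mulmxBl -scalemxAl raddfB /= mxtraceZ mulmx_suml mxtrace_sum.
  rewrite (bigD1 k) //= big1 => [|l nlk].
    by rewrite -scalemxAl mxtraceZ (mxtrace_mulC (L k)) Ltr eqxx mulr1n trC mulrC addr0 subrr.
  by rewrite -scalemxAl mxtraceZ (mxtrace_mulC (L l)) Ltr eq_sym (negPf nlk) mulr0.
have -> : \tr (D *m D^t*) = n.+1%:R * (n.+1%:R * \tr (A *m A^t*) - \sum_k `|c k| ^+ 2).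
  rewrite {2}/D adjmxD adjmxN adjmxZ rmorph_nat adjmx_sum mulmxBr -scalemxAr.
  rewrite mulmx_sumr raddfB /= mxtraceZ DA mxtrace_sum [X in _ - X = _]big1 ?subr0 // => k _.
  by rewrite adjmxZ -scalemxAr /= mxtraceZ DL mulr0.
by rewrite pmulr_rge0 ?ltr0Sn // subr_ge0.
Qed.

(* The expectation of the Choi matrix of F in the vector [sum_i M e_i (x) e_i]. *)
Definition choi_overlap n (M : 'M[C]_n) (F : superop R n n) : C :=
  \sum_i \sum_j (M^t* *m F (delta_mx i j) *m M) i j.

(** The Choi matrix of K . K^* is the rank-one matrix of the vector of K, so the expectation is a
    squared inner product. *)
Lemma choi_overlap_two_sided n (M K : 'M[C]_n) :
  choi_overlap M (two_sided K K) = `|\tr (M^t* *m K)| ^+ 2.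
Proof.
rewrite normCK /mxtrace rmorph_sum mulr_suml; apply: eq_bigr => i _.
rewrite mulr_sumr; apply: eq_bigr => j _.
have -> : M^t* *m two_sided K K (delta_mx i j) *m M =
    (M^t* *m K) *m delta_mx i j *m (M^t* *m K)^t*.
  by rewrite two_sidedE adjmxM trmxCK !mulmxA.
exact: mulmx_deltaE.
Qed.

Lemma choi_overlap_sum n (M : 'M[C]_n) (I : finType) (P : pred I)
    (t : I -> C) (F : I -> superop R n n) :
  choi_overlap M (\sum_(k | P k) t k *: F k) =
  \sum_(k | P k) t k * choi_overlap M (F k).
Proof.
have lin c (F1 F2 : superop R n n) :
    choi_overlap M (c *: F1 + F2) = c * choi_overlap M F1 + choi_overlap M F2.
  rewrite mulr_sumr -big_split; apply: eq_bigr => i _ /=.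
  rewrite mulr_sumr -big_split; apply: eq_bigr => j _ /=.
  by rewrite add_lfunE scale_lfunE mulmxDr mulmxDl -scalemxAr -scalemxAl !mxE.
elim/big_rec2: _ => [|k x F' _ <-]; last exact: lin.
have := lin (-1) 0 0; rewrite scaleN1r oppr0 addr0 => ->.
by rewrite mulN1r addNr.
Qed.

(** The inner product of M with A (x) B is a sum over k of products of a coefficient on each side.
    Cauchy-Schwarz separates the sides, and Bessel bounds them by [a] and [b] times the squared
    norms of A and B. *)
Lemma choi_overlap_product_le a b (K : finType) (p : K -> C)
    (L : K -> 'M[C]_a) (Q : K -> 'M[C]_b) (A : 'M[C]_a) (B : 'M[C]_b) :
  (forall k, `|p k| <= 1) ->
  (forall k, L k \is unitarymx) -> (forall k, Q k \is unitarymx) ->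
  (forall k k', k != k' -> \tr ((L k)^t* *m L k') = 0) ->
  (forall k k', k != k' -> \tr ((Q k)^t* *m Q k') = 0) ->
  choi_overlap (\sum_k p k *: (L k *t Q k)) (two_sided (A *t B) (A *t B)) <=
  (a * b)%:R * \tr (two_sided (A *t B) (A *t B) 1%:M).
Proof.
move=> p1 Lu Qu Lo Qo; rewrite choi_overlap_two_sided two_sidedE mulmx1.
rewrite adjmx_sum mulmx_suml mxtrace_sum.
have -> : \sum_k \tr ((p k *: (L k *t Q k))^t* *m (A *t B)) =
   \sum_k ((p k)^* * \tr ((L k)^t* *m A)) * \tr ((Q k)^t* *m B).
  apply: eq_bigr => k _; rewrite adjmxZ -scalemxAl mxtraceZ adjmx_tens tensmx_mul.
  by rewrite mxtrace_tens mulrA.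
apply: le_trans (sum_norm_cauchy_schwarz _ _) _.
rewrite adjmx_tens tensmx_mul mxtrace_tens natrM mulrACA.
apply: ler_pM; try by apply: sumr_ge0 => k _; rewrite exprn_ge0.
  apply: le_trans (hilbert_schmidt_bessel A Lu Lo); apply: ler_sum => k _.
  by rewrite normrM norm_conjC exprMn ler_piMl ?exprn_ge0 ?exprn_ile1.
exact: hilbert_schmidt_bessel.
Qed.

Lemma choi_overlap_separable a b (K : finType) (p : K -> C)
    (L : K -> 'M[C]_a) (Q : K -> 'M[C]_b) F :
  (forall k, `|p k| <= 1) ->
  (forall k, L k \is unitarymx) -> (forall k, Q k \is unitarymx) ->
  (forall k k', k != k' -> \tr ((L k)^t* *m L k') = 0) ->
  (forall k k', k != k' -> \tr ((Q k)^t* *m Q k') = 0) ->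
  separable F ->
  0 <= choi_overlap (\sum_k p k *: (L k *t Q k)) F <= (a * b)%:R * \tr (F 1%:M).
Proof.
move=> p1 Lu Qu Lo Qo; set M := \sum_k _.
have ovD F1 F2 : choi_overlap M (F1 + F2) = choi_overlap M F1 + choi_overlap M F2.
  have := choi_overlap_sum M xpredT (fun=> 1) (fun i => if i then F1 else F2).
  by rewrite !big_bool !scale1r !mul1r.
elim=> [|A B {}F _ /andP[F0 FS]].
  (* Additivity at 0 + 0 makes the overlap of the zero map vanish. *)
  have := ovD 0 0; rewrite addr0 => /eqP; rewrite -subr_eq subrr eq_sym => /eqP ->.
  by rewrite lfunE /= linear0 mulr0 lexx.
rewrite ovD add_lfunE raddfD mulrDr /=; apply/andP; split.
  by apply: addr_ge0 F0; rewrite choi_overlap_two_sided exprn_ge0.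
by apply: lerD => //; apply: choi_overlap_product_le.
Qed.

(** For an outcome with overlap x and y = ab tr (E_k 1), the bounds 0 <= x <= y give |2 x - y| <= y,
    whichever sign the outcome carries. Trace preservation makes the y sum to (ab)^2. *)
Lemma LOCC_witness a b (K : finType) (p : K -> C)
    (L : K -> 'M[C]_a) (Q : K -> 'M[C]_b) F :
  (forall k, `|p k| <= 1) ->
  (forall k, L k \is unitarymx) -> (forall k, Q k \is unitarymx) ->
  (forall k k', k != k' -> \tr ((L k)^t* *m L k') = 0) ->
  (forall k k', k != k' -> \tr ((Q k)^t* *m Q k') = 0) ->
  LOCC F ->
  `|2 * choi_overlap (\sum_k p k *: (L k *t Q k)) F - (a * b)%:R * \tr (F 1%:M)|
  <= (a * b)%:R ^+ 2.
Proof.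
move=> p1 Lu Qu Lo Qo [J [E [s [[I [P [f [prot EP]]]] ->]]]].
have [Psep Ptp] := locc_protocol_separable prot.
have Esep k : separable (E k) by rewrite EP; apply: separable_sum.
rewrite choi_overlap_sum sum_lfunE mxtrace_sum !mulr_sumr -sumrB.
apply: le_trans (ler_norm_sum _ _ _) _.
apply: (@le_trans _ _ (\sum_k (a * b)%:R * \tr (E k 1%:M))).
  apply: ler_sum => k _; rewrite scale_lfunE /= mxtraceZ.
  rewrite !(mulrCA _ ((-1) ^+ _)) -mulrBr normrM normr_sign mul1r.
  have /andP[x0 xy] := choi_overlap_separable p1 Lu Qu Lo Qo (Esep k).
  move: x0 xy; set x := choi_overlap _ _; set y := _ * _ => x0 xy.
  have xr := ger0_real x0; have yr := ger0_real (le_trans x0 xy).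
  rewrite real_ler_norml; last exact: realB (realM (realn _ 2) xr) yr.
  by rewrite lerBrDr addNr mulr_ge0 //= lerBlDr -mulr2n -[leRHS]mulr_natl ler_pM2l.
rewrite -mulr_sumr -mxtrace_sum.
(* Coarse-graining only groups the branches by label, so the total map is unchanged. *)
rewrite -sum_lfunE; have -> : \sum_k E k = \sum_i P i.
  by rewrite [RHS](partition_big f xpredT) //=; apply: eq_bigr => k _; rewrite EP.
by rewrite Ptp mxtrace1 expr2.
Qed.
End Witness.

(** * Local decompositions *)

Section Decompositions.
Variable R : realType.
Local Notation C := R[i].

(** Allows any finite index type, even an empty one: the extra index [None] carries [F0] with
    coefficient 0 and guarantees at least one term. *)
Lemma decomposition_cost_fin m n (S : superop R m n -> Prop) F0 (I : finType)
    (t : I -> R) (F : I -> superop R m n) :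
  S F0 -> (forall i, S (F i)) ->
  decomposition_cost S (\sum_i (t i)%:C *: F i) (\sum_i `|t i|).
Proof.
move=> SF0 SF.
pose t' (o : option I) := if o is Some i then t i else 0.
pose F' (o : option I) := if o is Some i then F i else F0.
have enum_sum (V : nmodType) (G : option I -> V) :
    \sum_(i < #|{: option I}|) G (enum_val i) = G None + \sum_i G (Some i).
  rewrite -(big_enum_val G) (bigD1 None) //=.
  congr (_ + _); rewrite (reindex_omap Some id) => [|[]//].
  by apply: eq_bigl => i; rewrite /= eqxx.
exists #|{: option I}|, (fun i => t' (enum_val i)), (fun i => F' (enum_val i)).
split=> [|i||]; first by rewrite card_option.
- by case: (enum_val i) => [j|] /=.
- by rewrite (enum_sum _ (fun o => (t' o)%:C *: F' o)) /= scale0r add0r.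
- by rewrite (enum_sum _ (fun o => `|t' o|)) /= normr0 add0r.
Qed.

Lemma cp0 m n : completely_positive (0 : superop R m n).
Proof. by rewrite -(scale0r (two_sided 0 0)); apply/cpZ/cp_two_sided. Qed.

Lemma cptp_id n : CPTP (\1%VF : superop R n n).
Proof.
split=> [|X]; last by rewrite id_lfunE.
by rewrite -two_sided1; apply: cp_two_sided.
Qed.

Lemma trace_two_sided n (K : 'M[C]_n) X :
  K \is unitarymx -> \tr (two_sided K K X) = \tr X.
Proof.
move=> /unitarymxP/mulmx1C KK.
by rewrite two_sidedE mxtrace_mulC mulmxA KK mul1mx.
Qed.

Lemma signed_localN n (F : superop R n n) : signed_local F -> signed_local (- F).
Proof.
case=> Ap [Am [p m pm ->]]; exists Am, Ap.
by split; [exact: m|exact: p|rewrite addrC|rewrite opprB].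
Qed.

Lemma signed_local_unitary n (K : 'M[C]_n) :
  K \is unitarymx -> signed_local (two_sided K K).
Proof.
move=> Ku; exists (two_sided K K), 0; rewrite addr0 subr0.
split; [exact: cp_two_sided|exact: cp0| |by []].
by split=> [|X]; [exact: cp_two_sided|rewrite trace_two_sided].
Qed.

Definition cross n (z : C) (K L : 'M[C]_n) : superop R n n :=
  2^-1 *: (z *: two_sided K L + z^* *: two_sided L K).

Lemma crossE n (z : C) (K L : 'M[C]_n) X :
  cross z K L X = 2^-1 *: (z *: (K *m X *m L^t*) + z^* *: (L *m X *m K^t*)).
Proof. by rewrite scale_lfunE add_lfunE 2!scale_lfunE 2!two_sidedE. Qed.

Lemma two_sided_combination n (w : C) (K L : 'M[C]_n) :
  two_sided (K + w *: L) (K + w *: L) =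
  two_sided K K + (w * w^*) *: two_sided L L +
  (w^* *: two_sided K L + w *: two_sided L K).
Proof.
rewrite two_sidedDl !two_sidedDr !two_sidedZl !two_sidedZr scalerA.
move: (two_sided K K) (two_sided K L) (two_sided L K) (two_sided L L) => x y z t.
move: (w^* *: y) (w *: z) (_ *: t) => {}y {}z {}t.
by rewrite [X in _ + X = _]addrC addrACA.
Qed.

(* The two signs of [K ± z^* L] interfere into the cross term while the
   diagonal parts add up to the channel (K·K^* + L·L^* )/2. *)
Lemma signed_local_cross n z (K L : 'M[C]_n) : `|z| = 1 ->
  K \is unitarymx -> L \is unitarymx -> signed_local (cross z K L).
Proof.
move=> z1 Ku Lu.
(* Used at w = z^* and w = - z^*, since the conjugate of w multiplies K . L^*. The factor 1/4 makes
   the difference of the two equal to [cross] and their sum trace preserving. *)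
pose A w : superop R n n := 4^-1 *: two_sided (K + w *: L) (K + w *: L).
have zz : z^* * z = 1 by rewrite mulrC -normCK z1 expr1n.
have Acp w : completely_positive (A w).
  by apply: cpZ (cp_two_sided _); rewrite invr_ge0 ler0n.
have quarter (X : superop R n n) : 4^-1 *: (X + X) = 2^-1 *: X.
  by rewrite -mulr2n -[X *+ 2]scaler_nat scalerA; congr (_ *: _); field.
have AD : A z^* + A (- z^*) = 2^-1 *: (two_sided K K + two_sided L L).
  rewrite /A -scalerDr !two_sided_combination rmorphN /= !conjCK mulrNN
    zz !scale1r.
  rewrite !scaleNr -opprD.
  move: (two_sided K K) (two_sided L L) (two_sided K L) (two_sided L K) => x y z' t.
  move: (x + y) (_ *: z' + _) => D O.
  by rewrite addrACA subrr addr0 quarter.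
have AB : A z^* - A (- z^*) = cross z K L.
  rewrite /A /cross -scalerBr !two_sided_combination rmorphN /= !conjCK mulrNN
    zz !scale1r.
  rewrite !scaleNr -opprD.
  move: (two_sided K K) (two_sided L L) (two_sided K L) (two_sided L K) => x y z' t.
  move: (x + y) (_ *: z' + _) => D O.
  by rewrite opprB [D + O]addrC addrACA subrr addr0 quarter.
exists (A z^*), (A (- z^*)); rewrite AB.
split; [exact: Acp|exact: Acp| |by []].
rewrite AD; split=> [|X].
  apply: cpZ; first by rewrite invr_ge0 ler0n.
  by apply: cpD; apply: cp_two_sided.
rewrite scale_lfunE add_lfunE mxtraceZ raddfD /= !trace_two_sided //.
move: (\tr X) => x.
by rewrite -mulr2n -[x *+ 2]mulr_natl mulKf ?pnatr_eq0.
Qed.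

Opaque cross.

End Decompositions.

(** * Local operations as LOCC maps *)

Section Embedding.
Variable R : realType.
Local Notation C := R[i].

(** Two rounds without communication: each party in turn applies the instrument formed by its
    positive and negative parts, and the sign is the product of the two outcome signs. *)
Lemma LO_sub_LOCC a b (F : superop R (a * b) (a * b)) : LO F -> LOCC F.
Proof.
case=> _ [_ [[Ap [Am [Apc Amc [_ Atp] ->]]] [Bp [Bm [Bpc Bmc [_ Btp] ->]]] ->]].
pose A i := if i then Ap else Am; pose B j := if j then Bp else Bm.
have Ai : instrument A.
  split; first by case; [exact: Apc|exact: Amc].
  rewrite big_bool.
  exact: Atp.
have Bi : instrument B.
  split; first by case; [exact: Bpc|exact: Bmc].
  rewrite big_bool.
  exact: Btp.
pose T := {i : bool & {j : bool & unit}}.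
(* The identity maps are kept so that [P] has the shape produced by [Locc_round] and [Locc_done]. *)
pose P (k : T) : superop R (a * b) (a * b) :=
  ((\1%VF \o tens_op \1%VF (B (tag (tagged k)))) \o tens_op (A (tag k)) \1%VF)%VF.
(* [true] marks the positive part, hence the negations; exclusive or multiplies the signs. *)
exists T, P, (fun k => ~~ (tag k) (+) ~~ (tag (tagged k))); split.
  exists T, P, id; split=> [|k]; last by rewrite big_pred1_eq.
  apply: (Locc_round (W := fun i => tens_op (A i) \1%VF) (J := fun=> {j : bool & unit})
    (P := fun _ (j : {j : bool & unit}) => (\1%VF \o tens_op \1%VF (B (tag j)))%VF)).
    left; exists A, (fun=> \1%VF).
    by split; [exact: Ai | move=> i; exact: cptp_id | done].
  move=> _; apply: (Locc_round (W := fun j => tens_op \1%VF (B j)) (J := fun=> unit)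
    (P := fun _ _ => \1%VF)) => [|_]; last exact: Locc_done.
  by right; exists (fun=> \1%VF), B; split; [move=> i; exact: cptp_id | exact: Bi | done].
pose mk i j : T := existT _ i (existT _ j tt).
have -> : \sum_(k : T) (-1) ^+ (~~ tag k (+) ~~ tag (tagged k)) *: P k =
    \sum_i \sum_j (-1) ^+ (~~ i (+) ~~ j) *: P (mk i j).
  rewrite pair_bigA (reindex (fun p : bool * bool => mk p.1 p.2)) //=.
  by exists (fun k : T => (tag k, tag (tagged k))) => [[]|[i [j []]]].
have PE i j : P (mk i j) = tens_op (A i) (B j).
  rewrite /P /= comp_lfun1l; apply: superop_tens_eq => X Y.
  rewrite comp_lfunE tens_opE [RHS]tens_opE [LHS]tens_opE.
  by rewrite [in LHS]id_lfunE [in LHS]id_lfunE.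
rewrite tens_opDl 2!tens_opDr 2!tens_opNl 2!tens_opNr opprK.
rewrite big_bool [X in _ = X + _]big_bool [X in _ = _ + X]big_bool.
rewrite 4!PE.
rewrite /=.
move: (tens_op Ap Bp) (tens_op Am Bp) (tens_op Ap Bm) (tens_op Am Bm) => x y z t.
by rewrite expr0 expr1 2!scale1r 2!scaleN1r.
Qed.
End Embedding.

(** * Phases and the splitting of cross terms *)

Section Bounds.
Variable R : realType.
Local Notation C := R[i].

Lemma norm_normc (x : C) : `|x| = (normc x)%:C.
Proof. by []. Qed.

(** The value 1 at zero gives every phase modulus 1, so [phaseE] and [norm_phase] hold
    unconditionally. *)
Definition phase (x : C) : C := if x == 0 then 1 else x / `|x|.

Lemma norm_phase x : `|phase x| = 1.
Proof.
rewrite /phase; have [_|x0] := eqVneq x 0; first exact: normr1.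
by rewrite normrM normfV normr_id divff ?normr_eq0.
Qed.

Lemma phaseE x : x = `|x| * phase x.
Proof.
rewrite /phase; have [->|x0] := eqVneq x 0; first by rewrite normr0 mul0r.
by rewrite mulrC divfK ?normr_eq0.
Qed.

Lemma phase_conjM x : (phase x)^* * x = `|x|.
Proof.
rewrite {2}[x]phaseE mulrCA mulrA -mulrA [_^* * _]mulrC -normCK.
by rewrite norm_phase expr1n mulr1.
Qed.

Lemma tens_op_crossE a b (z w : C) (K L : 'M[C]_a) (K' L' : 'M[C]_b) X Y :
  tens_op (cross z K L) (cross w K' L') (X *t Y) =
  (2^-1 *: (z *: (K *m X *m L^t*) + z^* *: (L *m X *m K^t*))) *t
  (2^-1 *: (w *: (K' *m Y *m L'^t*) + w^* *: (L' *m Y *m K'^t*))).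
Proof. by apply: etrans (tens_opE _ _ _ _) _; congr (_ *t _); exact: crossE. Qed.

(* [cross z K L] is the real part of [z (K . L^* )] and [cross (- 'i * z) K L] its
   imaginary part, so the left-hand side is Re (x) Re - Im (x) Im. *)
Lemma cross_tensor a b (z : C) (K L : 'M[C]_a) (K' L' : 'M[C]_b) :
  tens_op (cross z K L) (cross 1 K' L') -
  tens_op (cross (- 'i * z) K L) (cross (- 'i) K' L') =
  2^-1 *: (z *: two_sided (K *t K') (L *t L') +
           z^* *: two_sided (L *t L') (K *t K')).
Proof.
apply: superop_tens_eq => X Y.
have LE := congr2 (fun x y => x - y) (tens_op_crossE z 1 K L K' L' X Y)
  (tens_op_crossE (- 'i * z) (- 'i) K L K' L' X Y).
have RE : (2^-1 *: (z *: two_sided (K *t K') (L *t L') +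
      z^* *: two_sided (L *t L') (K *t K'))) (X *t Y) =
    2^-1 *: (z *: ((K *m X *m L^t*) *t (K' *m Y *m L'^t*)) +
      z^* *: ((L *m X *m K^t*) *t (L' *m Y *m K'^t*))).
  rewrite scale_lfunE add_lfunE 2!scale_lfunE; congr (_ *: (_ *: _ + _ *: _));
    by rewrite two_sidedE adjmx_tens 2!tensmx_mul.
rewrite add_lfunE opp_lfunE.
apply: etrans LE (etrans _ (esym RE)).
move: (K *m X *m _) (L *m X *m _) (K' *m Y *m _) (L' *m Y *m _) => x x' y y'.
rewrite rmorphM !rmorphN /= !conjCi !opprK rmorph1.
apply/matrixP => i j; rewrite !mxE.
move: (x _ _) (x' _ _) (y _ _) (y' _ _) => {}x {}x' {}y {}y'.
set l := LHS.
(* Isolating the product of 'i with itself lets it be replaced by -1 before [field] finishes. *)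
have -> : l = 4^-1 * ((z * x + z^* * x') * (y + y') -
    'i * 'i * (z^* * x' - z * x) * (y' - y)) by rewrite /l; field.
by rewrite -expr2 sqrCi; field.
Qed.

End Bounds.

(** * The two bounds on the decomposition cost *)

Section Gamma.
Variable R : realType.
Local Notation C := R[i].

Lemma norm_real_complex (x : R) : `|x%:C : C| = (`|x|)%:C.
Proof. by rewrite norm_normc /= expr0n addr0 sqrtr_sqr. Qed.

(** The index type has one summand for the diagonal terms and one each for the two products in
    [cross_tensor]. Each ordered pair thus occurs twice with weight |u_k| |u_k'|, whence the factor
    2. *)
Lemma LO_decomposition a b (K : finType) (u : K -> C)
    (L : K -> 'M[C]_a) (Q : K -> 'M[C]_b) :
  (forall k, L k \is unitarymx) -> (forall k, Q k \is unitarymx) ->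
  let U := \sum_k u k *: (L k *t Q k) in
  decomposition_cost (@LO R a b) (two_sided U U)
    (\sum_k normc (u k) ^+ 2 +
     2 * \sum_k \sum_(k' | k != k') normc (u k) * normc (u k')).
Proof.
move=> Lu Qu U.
pose z p := phase (u p.1) * (phase (u p.2))^*.
(* Zero on the diagonal, so that sums may run over all pairs. *)
pose w (p : K * K) : R := if p.1 != p.2 then normc (u p.1) * normc (u p.2) else 0.
pose G p := tens_op (cross (z p) (L p.1) (L p.2)) (cross 1 (Q p.1) (Q p.2)).
pose H p := tens_op (cross (- 'i * z p) (L p.1) (L p.2)) (cross (- 'i) (Q p.1) (Q p.2)).
pose D k := tens_op (two_sided (L k) (L k)) (two_sided (Q k) (Q k)).
pose t (i : K + (K * K + K * K)) : R :=
  match i with inl k => normc (u k) ^+ 2 | inr (inl p) => w p | inr (inr p) => - w p end.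
pose F (i : K + (K * K + K * K)) : superop R (a * b) (a * b) :=
  match i with inl k => D k | inr (inl p) => G p | inr (inr p) => H p end.
have w_ge0 p : 0 <= w p.
  by rewrite /w; case: ifP => // _; rewrite mulr_ge0 // -ler0c -norm_normc.
have z1 p : `|z p| = 1 by rewrite normrM norm_conjC !norm_phase mulr1.
have i1 : `|- 'i : C| = 1 by rewrite normrN normCi.
have LO_F i : LO (F i).
  case: i => [k|[p|p]].
  - by exists (two_sided (L k) (L k)), (two_sided (Q k) (Q k));
      split; [exact: signed_local_unitary|exact: signed_local_unitary|].
  - exists (cross (z p) (L p.1) (L p.2)), (cross 1 (Q p.1) (Q p.2)).
    by split; [exact: signed_local_cross|apply: signed_local_cross; rewrite ?normr1|].
  - exists (cross (- 'i * z p) (L p.1) (L p.2)), (cross (- 'i) (Q p.1) (Q p.2)).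
    split; [apply: signed_local_cross => //|exact: signed_local_cross|by []].
    by rewrite normrM z1 i1 mulr1.
(* The padding element for [decomposition_cost_fin]. *)
have LO_1 : LO (tens_op (two_sided (1%:M : 'M[C]_a) 1%:M) (two_sided (1%:M : 'M_b) 1%:M)).
  have one_unitary n : (1%:M : 'M[C]_n) \is unitarymx.
    by apply/unitarymxP; rewrite adjmx1 mulmx1.
  by exists (two_sided 1%:M 1%:M), (two_sided 1%:M 1%:M);
    split; [exact: signed_local_unitary|exact: signed_local_unitary|].
have sum_w : \sum_p w p = \sum_k \sum_(k' | k != k') normc (u k) * normc (u k').
  rewrite -(pair_bigA _ (fun k k' => w (k, k'))); apply: eq_bigr => k _.
  by rewrite [RHS]big_mkcond.
have <- : \sum_i `|t i| =
    \sum_k normc (u k) ^+ 2 +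
     2 * \sum_k \sum_(k' | k != k') normc (u k) * normc (u k').
  rewrite big_sumType big_sumType /= -sum_w mulr_natl mulr2n; congr (_ + (_ + _)).
  - by apply: eq_bigr => k _; rewrite ger0_norm ?sqr_ge0.
  - by apply: eq_bigr => p _; rewrite ger0_norm.
  - by apply: eq_bigr => p _; rewrite normrN ger0_norm.
suff -> : two_sided U U = \sum_i (t i)%:C *: F i by exact: decomposition_cost_fin LO_1 LO_F.
pose X k k' := two_sided (L k *t Q k) (L k' *t Q k').
pose Y p := (w p)%:C *: (z p *: X p.1 p.2).
have YE p : Y p = if p.1 != p.2 then u p.1 *: ((u p.2)^* *: X p.1 p.2) else 0.
  rewrite /Y /w; case: ifP => _; last by rewrite scale0r.
  rewrite !scalerA; congr (_ *: _).
  rewrite {2}[u p.1]phaseE {2}[u p.2]phaseE [in RHS]rmorphM /= conj_normC.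
  by rewrite [RHS]mulrACA [(_ * _)%:C]rmorphM.
(* A pair contributes half of its own term and half of the adjoint term. Swapping the components of
   the pair shows that both families have the same sum. *)
have sum_Y : \sum_p (w p)%:C *: (G p - H p) = \sum_p Y p.
  have YS : \sum_p (w p)%:C *: ((z p)^* *: X p.2 p.1) = \sum_p Y p.
    have swapK : involutive (fun p : K * K => (p.2, p.1)) by case.
    rewrite [RHS](reindex_inj (inv_inj swapK)); apply: eq_bigr => p _.
    by rewrite /Y /w /z /= eq_sym [normc (u p.2) * _]mulrC rmorphM /= conjCK [_ * phase _]mulrC.
  have GH p : (w p)%:C *: (G p - H p) =
      2^-1 *: (Y p + (w p)%:C *: ((z p)^* *: X p.2 p.1)).
    have scaleAC (V : lmodType C) (x c y y' : C) (v v' : V) :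
        x *: (c *: (y *: v + y' *: v')) = c *: (x *: (y *: v) + x *: (y' *: v')).
      by rewrite -scalerDr !scalerA [c * x]mulrC.
    apply: etrans (scaleAC _ _ _ _ _ _ _); congr (_ *: _); exact: cross_tensor.
  have -> : \sum_p (w p)%:C *: (G p - H p) = 2^-1 *: (\sum_p Y p + \sum_p Y p).
    rewrite -[in X in _ + X]YS -big_split scaler_sumr.
    by apply: eq_bigr => p _; exact: GH.
  move: (\sum_p Y p) => S.
  exact: scale_half_double.
have split_RHS : \sum_i (t i)%:C *: F i =
    \sum_k (normc (u k) ^+ 2)%:C *: X k k + \sum_p Y p.
  rewrite big_sumType big_sumType /= -sum_Y -big_split; congr (_ + _).
    by apply: eq_bigr => k _; rewrite /D tens_op_two_sided.
  by apply: eq_bigr => p _ /=; rewrite rmorphN scaleNr scalerBr.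
rewrite split_RHS {1}/U two_sided_suml.
rewrite -(pair_bigA _ (fun k k' => Y (k, k'))) -big_split; apply: eq_bigr => k _ /=.
have -> : two_sided (u k *: (L k *t Q k)) U =
    \sum_k' u k *: ((u k')^* *: X k k').
  rewrite two_sidedZl /U two_sided_sumr scaler_sumr; apply: eq_bigr => k' _.
  by congr (_ *: _); exact: two_sidedZr.
rewrite [LHS](bigD1 k isT); congr (_ + _).
  by rewrite scalerA -normCK norm_normc rmorphXn.
rewrite [LHS]big_mkcond; apply: eq_bigr => k' _.
by rewrite YE /= eq_sym.
Qed.

(** Linearity turns the bound of [LOCC_witness] into (ab)^2 c for a decomposition of cost c;
    comparing with the value at U and cancelling (ab)^2 gives the claim. *)
Lemma LOCC_cost_lower a b (K : finType) (u : K -> C)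
    (L : K -> 'M[C]_a) (Q : K -> 'M[C]_b) c :
  (0 < a * b)%N ->
  (forall k, L k \is unitarymx) -> (forall k, Q k \is unitarymx) ->
  (forall k k', k != k' -> \tr ((L k)^t* *m L k') = 0) ->
  (forall k k', k != k' -> \tr ((Q k)^t* *m Q k') = 0) ->
  let U := \sum_k u k *: (L k *t Q k) in
  U \is unitarymx -> decomposition_cost (@LOCC R a b) (two_sided U U) c ->
  2 * (\sum_k normc (u k)) ^+ 2 - 1 <= c.
Proof.
move=> ab_gt0 Lu Qu Lo Qo U Uu [l [t [F [_ LOCC_F FE ->]]]].
pose p k := phase (u k); pose M := \sum_k p k *: (L k *t Q k).
set N : C := (a * b)%:R.
have p1 k : `|p k| <= 1 by rewrite norm_phase.
have wit i := LOCC_witness p1 Lu Qu Lo Qo (LOCC_F i).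
have N0 : 0 < N by rewrite ltr0n.
(* Orthogonality removes the pairs of distinct indices, and the conjugate phases in M turn each u_k
   into |u_k|. *)
have trU : \tr (M^t* *m U) = N * (\sum_k normc (u k))%:C.
  rewrite adjmx_sum mulmx_suml mxtrace_sum rmorph_sum mulr_sumr; apply: eq_bigr => k _.
  rewrite adjmxZ -scalemxAl mxtraceZ mulmx_sumr mxtrace_sum (bigD1 k) //= big1 => [|k' nk].
    rewrite addr0 -scalemxAr mxtraceZ adjmx_tens tensmx_mul.
    have /unitarymxP/mulmx1C-> := Lu k; have /unitarymxP/mulmx1C-> := Qu k.
    by rewrite tensmx11 mxtrace1 mulrA phase_conjM mulrC.
  by rewrite -scalemxAr mxtraceZ adjmx_tens tensmx_mul mxtrace_tens Lo 1?eq_sym // mul0r mulr0.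
have gU : 2 * choi_overlap M (two_sided U U) - N * \tr (two_sided U U 1%:M) =
    N ^+ 2 * (2 * (\sum_k normc (u k)) ^+ 2 - 1)%:C.
  rewrite choi_overlap_two_sided trU trace_two_sided // mxtrace1.
  rewrite normrM (ger0_norm (ltW N0)) ger0_norm; last first.
    by rewrite ler0c sumr_ge0 // => k _; rewrite -ler0c -norm_normc.
  move: (\sum_k normc (u k)) => S.
  have -> : (2 * S ^+ 2 - 1)%:C = 2 * S%:C ^+ 2 - 1 :> C.
    by rewrite rmorphB rmorphM rmorphXn rmorph1 rmorph_nat.
  by rewrite -/N; ring.
have : `|2 * choi_overlap M (two_sided U U) - N * \tr (two_sided U U 1%:M)| <=
    N ^+ 2 * (\sum_i `|t i|)%:C.
  rewrite FE choi_overlap_sum sum_lfunE mxtrace_sum !mulr_sumr -sumrB.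
  apply: le_trans (ler_norm_sum _ _ _) _.
  rewrite rmorph_sum mulr_sumr; apply: ler_sum => i _.
  rewrite scale_lfunE mxtraceZ !(mulrCA _ (t i)%:C) -mulrBr normrM mulrC.
  by rewrite norm_real_complex ler_wpM2r // ler0c.
rewrite gU normrM ger0_norm ?exprn_ge0 ?(ltW N0) // ler_pM2l ?exprn_gt0 //.
move: (2 * _ - 1) (\sum_i `|t i|) => x y xy.
rewrite -lecR; apply: le_trans xy; apply: real_ler_norm.
by apply/complex_realP; exists x.
Qed.
End Gamma.

(** * Bounding the number of terms *)

Section Caratheodory.

(* Moving along a linear relation between the vectors in the support until a
   coefficient vanishes, in the direction that does not increase the sum. *)
Lemma caratheodory_step (R : realFieldType) (T : finType) l
    (v : 'I_l -> T -> R) (t : 'I_l -> R) :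
  (forall i, 0 <= t i) -> (#|T| < #|[set i | t i != 0%R]|)%N ->
  exists s : 'I_l -> R,
    [/\ forall i, 0 <= s i, forall x, \sum_i s i * v i x = \sum_i t i * v i x,
        \sum_i s i <= \sum_i t i
      & (#|[set i | s i != 0%R]| < #|[set i | t i != 0%R]|)%N].
Proof.
set S := [set i | t i != 0] => t_ge0 T_lt_S.
have [i1 i1S] : exists i, i \in S by apply/card_gt0P/(leq_ltn_trans _ T_lt_S).
have [mu [mu_nz muS mu_rel mu_sum]] : exists mu : 'I_l -> R,
    [/\ exists i, mu i != 0, forall i, i \notin S -> mu i = 0,
        forall x, \sum_i mu i * v i x = 0 & 0 <= \sum_i mu i].
  pose A := \matrix_(i < #|S|, j < #|T|) v (enum_val i) (enum_val j).
  (* The matrix has more rows than columns, so its left kernel is nonzero. *)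
  have /rowV0Pn[u /sub_kermxP uA u_nz] : kermx A != 0.
    rewrite kermx_eq0 /row_free neq_ltn (leq_ltn_trans (rank_leq_col _)) //.
  pose mu i := if i \in S then u 0 (enum_rank_in i1S i) else 0.
  have sum_mu (f : 'I_l -> R) : \sum_i mu i * f i = \sum_k u 0 k * f (enum_val k).
    rewrite (bigID (mem S)) /= [X in _ + X]big1 ?addr0 => [|i /negPf niS]; last first.
      by rewrite /mu niS mul0r.
    rewrite big_enum_val; apply: eq_bigr => k _.
    by rewrite /mu enum_valP enum_valK_in.
  have mu_nz : exists i, mu i != 0.
    have /rV0Pn[k uk] := u_nz; exists (enum_val k).
    by rewrite /mu enum_valP enum_valK_in.
  have muS i : i \notin S -> mu i = 0 by rewrite /mu => /negPf->.
  have mu_rel x : \sum_i mu i * v i x = 0.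
    rewrite sum_mu -[x]enum_rankK.
    have /rowP/(_ (enum_rank x)) := uA; rewrite !mxE; apply: etrans.
    by apply: eq_bigr => k _; rewrite mxE.
  have [sum_ge0|/ltW sum_le0] := leP 0 (\sum_i mu i); first by exists mu.
  exists (fun i => - mu i); split.
  - by have [i ?] := mu_nz; exists i; rewrite oppr_eq0.
  - by move=> i /muS->; rewrite oppr0.
  - by move=> x; under eq_bigr do rewrite mulNr; rewrite sumrN mu_rel oppr0.
  - by rewrite sumrN oppr_ge0.
(* If no entry were positive, the nonnegative sum would force all entries to vanish. *)
have [i2 mu_i2] : exists i, 0 < mu i.
  have [i mu_i] := mu_nz; apply/existsP; apply: contraNT mu_i => /existsPn mu_le0.
  have muN_ge0 j : 0 <= - mu j by rewrite oppr_ge0 leNgt; exact: mu_le0.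
  have /eqP : \sum_j - mu j = 0.
    apply/eqP; rewrite eq_le sumrN oppr_le0 mu_sum /= -sumrN.
    by apply: sumr_ge0 => j _.
  rewrite psumr_eq0 => [|//]; move=> /allP/(_ i).
  by rewrite mem_index_enum oppr_eq0 /= => ->.
(* The smallest ratio is the longest step that keeps all coefficients nonnegative; it annihilates
   the one at [i0]. *)
have [i0 mu_i0 i0_min] :=
  @arg_minP _ _ _ i2 (fun i => 0 < mu i) (fun i => t i / mu i) mu_i2.
pose r := t i0 / mu i0; have r_ge0 : 0 <= r by rewrite divr_ge0 // ltW.
have s_i0 : t i0 - r * mu i0 = 0 by rewrite divfK ?subrr // gt_eqF.
exists (fun i => t i - r * mu i); split.
- move=> i; rewrite subr_ge0; have [mu_i|mu_i] := leP (mu i) 0.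
    by apply: le_trans (t_ge0 i); rewrite mulr_ge0_le0.
  by rewrite -ler_pdivlMr // i0_min.
- move=> x; under eq_bigr do rewrite mulrBl -mulrA.
  by rewrite sumrB -mulr_sumr mu_rel mulr0 subr0.
- by rewrite sumrB -mulr_sumr gerBl mulr_ge0.
apply: proper_card; apply/properP; split.
  apply/fintype.subsetP => i; rewrite !inE; apply: contraNN => /eqP ti.
  by rewrite ti muS ?mulr0 ?subr0 // inE ti eqxx.
exists i0; last by rewrite inE s_i0 eqxx.
by apply: contraLR mu_i0 => /muS->; rewrite ltxx.
Qed.

(** Iterates the step. The bound is [#|T|] rather than one more because the sum of the coefficients
    may decrease. *)
Lemma caratheodory (R : realFieldType) (T : finType) l
    (v : 'I_l -> T -> R) (t : 'I_l -> R) :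
  (forall i, 0 <= t i) ->
  exists s : 'I_l -> R,
    [/\ forall i, 0 <= s i, forall x, \sum_i s i * v i x = \sum_i t i * v i x,
        \sum_i s i <= \sum_i t i & (#|[set i | s i != 0%R]| <= #|T|)%N].
Proof.
have [m] := ubnP #|[set i | t i != 0]|; elim: m t => // m IH t tm t_ge0.
have [|/(caratheodory_step v t_ge0)[t' [t'_ge0 t'E t't t'S]]] :=
  leqP #|[set i | t i != 0]| #|T|; first by exists t.
have [s [s_ge0 sE st' sT]] := IH t' (leq_trans t'S tm) t'_ge0.
by exists s; split=> // [x|]; [rewrite sE | apply: le_trans t't].
Qed.

End Caratheodory.

Section FewTerms.
Variable R : realType.
Local Notation C := R[i].

(** Indexes real coordinates: input matrix unit, output entry, real or imaginary part. *)
Definition superop_coord m n : finType :=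
  (('I_m * 'I_m) * ('I_n * 'I_n) * bool)%type.

(** Closure under negation moves signs into the maps, leaving a nonnegative combination for
    [caratheodory]. The length no longer depends on the decomposition, so limits can be taken term
    by term. *)
Lemma decomposition_few_terms m n (S : superop R m n -> Prop) E c :
  (forall F, S F -> S (- F)) -> decomposition_cost S E c ->
  exists (t : 'I_#|superop_coord m n| -> R) F,
    [/\ forall i, 0 <= t i, forall i, S (F i), E = \sum_i (t i)%:C *: F i
      & \sum_i t i <= c].
Proof.
move=> SN [l [t [F [l_gt0 SF -> ->]]]].
pose F' i := if 0 <= t i then F i else - F i.
have SF' i : S (F' i) by rewrite /F'; case: ifP => // _; apply: SN.
pose v i (x : superop_coord m n) : R :=
  let z := F' i (delta_mx x.1.1.1 x.1.1.2) x.1.2.1 x.1.2.2 in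
  if x.2 then complex.Re z else complex.Im z.
have [s [s_ge0 sE st sT]] := caratheodory v (fun i => normr_ge0 (t i)).
have tE : \sum_i (t i)%:C *: F i = \sum_i (s i)%:C *: F' i.
  have -> : \sum_i (t i)%:C *: F i = \sum_i (`|t i|)%:C *: F' i.
    apply: eq_bigr => i _; rewrite /F'; case: ifP => [/ger0_norm->//|/negbT].
    by rewrite -ltNge => /ltr0_norm->; rewrite rmorphN scaleNr scalerN opprK.
  have ReIm (c' : 'I_l -> R) (z : 'I_l -> C) :
      \sum_i (c' i)%:C * z i =
      (\sum_i c' i * complex.Re (z i)) +i* (\sum_i c' i * complex.Im (z i)).
    elim/big_ind3: _ => [//|x1 x2 x3 y1 y2 y3 -> -> //|i _].
    by case: (z i) => x y; simpc.
  apply/lfunP => X; rewrite [X]matrix_sum_delta !linear_sum; apply: eq_bigr => i _.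
  rewrite !linear_sum; apply: eq_bigr => j _; rewrite !linearZ; congr (_ *: _).
  apply/matrixP => k k' /=.
  have coordE (c' : 'I_l -> R) :
      (\sum_i0 (c' i0)%:C *: F' i0)%VF (delta_mx i j) k k' =
      \sum_i0 (c' i0)%:C * F' i0 (delta_mx i j) k k'.
    by rewrite sum_lfunE summxE; apply: eq_bigr => i0 _; rewrite scale_lfunE mxE.
  rewrite !coordE !ReIm.
  have := sE (i, j, (k, k'), true); have := sE (i, j, (k, k'), false).
  by rewrite /v /= => -> ->.
(* The support is enumerated and padded with zero coefficients; past its end [nth] returns [i0], so
   the padding maps still satisfy [S]. *)
pose e := enum [set i | s i != 0]; pose i0 := Ordinal l_gt0.
have sum_e (V : nmodType) (g : 'I_l -> V) : (forall i, s i = 0 -> g i = 0) ->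
    \sum_i g i = \sum_(k < #|superop_coord m n|)
      if (k < size e)%N then g (nth i0 e k) else 0.
  move=> g0; rewrite (bigID [in [set i | s i != 0]]) /= [X in _ + X]big1 ?addr0; last first.
    by move=> i; rewrite inE negbK => /eqP/g0.
  rewrite -big_enum (big_nth i0) big_mkord.
  rewrite (big_ord_widen #|superop_coord m n| (fun k => g (nth i0 e k))) ?big_mkcond //.
  by rewrite -cardE.
exists (fun k => if (k < size e)%N then s (nth i0 e k) else 0).
exists (fun k : 'I__ => F' (nth i0 e k)).
split=> // [k||]; first by case: ifP.
- rewrite tE sum_e => [|i ->]; last by rewrite scale0r.
  by apply: eq_bigr => k _; case: ifP; rewrite ?scale0r.
- by rewrite -sum_e.
Qed.
End FewTerms.

(** * The minimum is attained *)

Section Ultralimit.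
Import numFieldNormedType.Exports.
Local Open Scope classical_set_scope.

(* A generalized limit that converges on every bounded sequence: identities and
   inequalities holding along a sequence pass to its limit without extracting
   subsequences. *)
Record is_ultralimit (R : realType) (lim : (nat -> R) -> R -> Prop) := IsUltralimit {
  ultralim_cst : forall c, lim (fun=> c) c;
  ultralimD : forall u v x y, lim u x -> lim v y -> lim (fun n => u n + v n) (x + y);
  ultralimM : forall u v x y, lim u x -> lim v y -> lim (fun n => u n * v n) (x * y);
  ultralim_le : forall u v x y,
    lim u x -> lim v y -> (forall n, u n <= v n) -> x <= y;
  ultralim_bounded : forall u M, (forall n, `|u n| <= M) -> exists x, lim u x;
  ultralim_harmonic : lim (fun n => n.+1%:R^-1) 0 }.

(** Convergence along an ultrafilter that refines the filter at infinity. Compactness of a closed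
    interval gives a bounded sequence a cluster point. *)
Lemma ultralimit_exists (R : realType) :
  exists lim : (nat -> R) -> R -> Prop, is_ultralimit lim.
Proof.
have [U [UU subU]] := ultraFilterLemma (eventually_filter).
have PU : ProperFilter U by apply: ultra_proper.
exists (fun u x => u @ U --> x); split.
- by move=> c; apply: cvg_cst.
- by move=> u v x y; apply: cvgD.
- by move=> u v x y; apply: cvgM.
- by move=> u v x y ux vy uv; apply: ler_cvg_to ux vy _; apply: nearW.
- move=> u M uM.
  have [|x [_ ux]] := @segment_compact R (- M) M (u @ U) (fmap_proper_filter u PU).
    apply: (@filterE _ U) => n; rewrite /= in_itv /= -ler_norml; exact: uM.
  (* An ultrafilter converges to its cluster points: otherwise it contains the complement of the
     preimage of [V], and that complement would meet [V]. *)
  exists x => V Vx; have [//|UVc] := in_ultra_setVsetC (u @^-1` V) UU.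
  have [y [nVy Vy]] := ux (~` V) V UVc Vx.
  by [].
- exact: cvg_trans (cvg_app _ subU) (@cvg_harmonic R).
Qed.

End Ultralimit.

(** * Limits of complex sequences and of superoperators *)

Section Limits.
Variables (R : realType) (lim : (nat -> R) -> R -> Prop).
Hypothesis limP : is_ultralimit lim.
Local Notation C := R[i].

Lemma ultralim_unique u x y : lim u x -> lim u y -> x = y.
Proof.
by move=> ux uy; apply/le_anti/andP; split; apply: (ultralim_le limP); eauto.
Qed.

Lemma ultralimB u v x y : lim u x -> lim v y -> lim (fun n => u n - v n) (x - y).
Proof.
move=> ux vy.
have := ultralimD limP ux (ultralimM limP (ultralim_cst limP (-1)) vy).
rewrite mulN1r; congr lim; apply/funext => n.
by rewrite mulN1r.
Qed.

Definition tends (u : nat -> C) (z : C) :=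
  lim (fun n => complex.Re (u n)) (complex.Re z) /\
  lim (fun n => complex.Im (u n)) (complex.Im z).

Lemma tends_cst c : tends (fun=> c) c.
Proof. by split; apply: (ultralim_cst limP). Qed.

Lemma tendsD u v x y : tends u x -> tends v y -> tends (fun n => u n + v n) (x + y).
Proof.
move=> [ur ui] [vr vi]; split; rewrite raddfD /=.
  by have := ultralimD limP ur vr; congr lim; apply/funext => n; rewrite raddfD.
by have := ultralimD limP ui vi; congr lim; apply/funext => n; rewrite raddfD.
Qed.

Lemma tendsM u v x y : tends u x -> tends v y -> tends (fun n => u n * v n) (x * y).
Proof.
move=> [ur ui] [vr vi]; split.
  have := ultralimB (ultralimM limP ur vr) (ultralimM limP ui vi).
  congr lim; last by case: x {ur ui} => ? ?; case: y {vr vi}.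
  by apply/funext => n; case: (u n) => ? ?; case: (v n).
have := ultralimD limP (ultralimM limP ur vi) (ultralimM limP ui vr).
congr lim; last by case: x {ur ui} => ? ?; case: y {vr vi}.
by apply/funext => n; case: (u n) => ? ?; case: (v n).
Qed.

Lemma tends_sum (I : finType) (u : I -> nat -> C) (z : I -> C) :
  (forall i, tends (u i) (z i)) -> tends (fun n => \sum_i u i n) (\sum_i z i).
Proof.
move=> uz; have -> : (fun n => \sum_i u i n) = \big[(fun u v n => u n + v n)/fun=> 0]_i u i.
  by apply/funext => n; elim/big_rec2: _ => // i v w _ <-.
by elim/big_rec2: _ => [|i v w _ vw]; [apply: tends_cst | apply: tendsD].
Qed.

Lemma tends_unique u x y : tends u x -> tends u y -> x = y.
Proof.
move=> [ur ui] [vr vi]; apply/eqP.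
by rewrite eq_complex (ultralim_unique ur vr) (ultralim_unique ui vi) !eqxx.
Qed.

(** Nonnegativity of a complex number also says that its imaginary part is zero, so both parts have
    to pass to the limit. *)
Lemma tends_ge0 u x : tends u x -> (forall n, 0 <= u n) -> 0 <= x.
Proof.
move=> [ur ui] u_ge0; rewrite lecE /=.
have uI n : complex.Im (u n) = 0 by apply: ger0_Im.
have -> : complex.Im x = 0.
  apply: ultralim_unique ui _.
  by have -> : (fun n => complex.Im (u n)) = fun=> 0; [exact/funext | exact: (ultralim_cst limP)].
rewrite eqxx; apply: (ultralim_le limP) (ultralim_cst limP 0) ur _ => n.
by have := u_ge0 n; rewrite lecE => /andP[].
Qed.

Lemma tends_real u x : lim u x -> tends (fun n => (u n)%:C) x%:C.
Proof. by move=> ux; split=> //=; apply: (ultralim_cst limP). Qed.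

Lemma tends_bounded u (M : R) : (forall n, `|u n| <= M%:C) -> exists z, tends u z.
Proof.
move=> uM.
have uR n : `|complex.Re (u n)| <= M.
  by rewrite -lecR; apply: le_trans (uM n); apply: normc_ge_Re.
(* Up to sign, the imaginary part is the real part of the product with 'i. *)
have uI n : `|complex.Im (u n)| <= M.
  rewrite -lecR; apply: le_trans (uM n).
  have := normc_ge_Re (u n * 'i%C); rewrite ReiNIm normrN normrM => /le_trans; apply.
  by rewrite (normc_def 'i%C) /= expr0n expr1n add0r sqrtr1 mulr1.
have [x ux] := ultralim_bounded limP uR; have [y uy] := ultralim_bounded limP uI.
by exists (x +i* y).
Qed.

Definition op_tends m n (F : nat -> superop R m n) (G : superop R m n) :=
  forall X k l, tends (fun N => F N X k l) (G X k l).

(** Limits are chosen on matrix units and extended linearly. *)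
Lemma op_tends_bounded m n (F : nat -> superop R m n) (M : R) :
  (forall N i j k l, `|F N (delta_mx i j) k l| <= M%:C) -> exists G, op_tends F G.
Proof.
move=> FM.
pose T := (('I_m * 'I_m) * ('I_n * 'I_n))%type.
have /choice[g gP] : forall x : T, exists z,
    tends (fun N => F N (delta_mx x.1.1 x.1.2) x.2.1 x.2.2) z.
  by move=> x; apply: tends_bounded => N; apply: FM.
pose f (X : 'M[C]_m) : 'M[C]_n :=
  \matrix_(k, l) \sum_i \sum_j X i j * g (i, j, (k, l)).
have lin : linear f.
  move=> c X Y; apply/matrixP => k l; rewrite !mxE mulr_sumr -big_split.
  apply: eq_bigr => i _; rewrite mulr_sumr -big_split; apply: eq_bigr => j _ /=.
  by rewrite !mxE mulrDl mulrA.
pose aux := GRing.isLinear.Build _ _ _ _ _ lin.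
pose h : {linear _ -> _} := HB.pack f aux.
exists (linfun h) => X k l; rewrite lfunE /= mxE.
have -> : (fun N => F N X k l) =
    fun N => \sum_i \sum_j X i j * F N (delta_mx i j) k l.
  apply/funext => N; rewrite {1}[X]matrix_sum_delta linear_sum summxE.
  apply: eq_bigr => i _; rewrite linear_sum summxE; apply: eq_bigr => j _.
  by rewrite linearZ mxE.
apply: tends_sum => i; apply: tends_sum => j.
by apply: tendsM (tends_cst _) (gP (i, j, (k, l))).
Qed.

Lemma op_tends_unique m n (F : nat -> superop R m n) G G' :
  op_tends F G -> op_tends F G' -> G = G'.
Proof.
move=> FG FG'; apply/lfunP => X; apply/matrixP => k l.
exact: tends_unique (FG X k l) (FG' X k l).
Qed.

Lemma op_tends_cst m n (F : superop R m n) : op_tends (fun=> F) F.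
Proof. by move=> X k l; apply: tends_cst. Qed.

Lemma op_tendsD m n (F F' : nat -> superop R m n) G G' :
  op_tends F G -> op_tends F' G' -> op_tends (fun N => F N + F' N) (G + G').
Proof.
move=> FG FG' X k l; have := tendsD (FG X k l) (FG' X k l).
by rewrite add_lfunE mxE; congr tends; apply/funext => N; rewrite add_lfunE mxE.
Qed.

Lemma op_tendsZ m n (t : nat -> C) c (F : nat -> superop R m n) G :
  tends t c -> op_tends F G -> op_tends (fun N => t N *: F N) (c *: G).
Proof.
move=> tc FG X k l; have := tendsM tc (FG X k l).
by rewrite scale_lfunE mxE; congr tends; apply/funext => N; rewrite scale_lfunE mxE.
Qed.

Lemma op_tendsB m n (F F' : nat -> superop R m n) G G' :
  op_tends F G -> op_tends F' G' -> op_tends (fun N => F N - F' N) (G - G').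
Proof.
move=> FG FG'; have := op_tendsD FG (op_tendsZ (tends_cst (-1)) FG').
by rewrite scaleN1r; congr op_tends; apply/funext => N; rewrite scaleN1r.
Qed.

Lemma op_tends_sum m n (I : finType) (F : I -> nat -> superop R m n) G :
  (forall i, op_tends (F i) (G i)) ->
  op_tends (fun N => \sum_i F i N) (\sum_i G i).
Proof.
move=> FG X k l; have := tends_sum (fun i => FG i X k l).
rewrite sum_lfunE summxE; congr tends; apply/funext => N.
by rewrite sum_lfunE summxE.
Qed.

Lemma op_tends_tens a b a' b' (F : nat -> superop R a a') F' (G : nat -> superop R b b') G' :
  op_tends F F' -> op_tends G G' ->
  op_tends (fun N => tens_op (F N) (G N)) (tens_op F' G').
Proof.
move=> FF GG X k l; rewrite tens_op_entry.
have -> : (fun N => tens_op (F N) (G N) X k l) = fun N => \sum_i \sum_j X i j *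
    (F N (delta_mx (mxtens_unindex i).1 (mxtens_unindex j).1)
       (mxtens_unindex k).1 (mxtens_unindex l).1 *
     G N (delta_mx (mxtens_unindex i).2 (mxtens_unindex j).2)
       (mxtens_unindex k).2 (mxtens_unindex l).2).
  apply/funext => N; rewrite tens_op_entry summxE; apply: eq_bigr => i _.
  by rewrite summxE; apply: eq_bigr => j _; rewrite mxE [X in _ * X]mxE.
rewrite summxE; apply: tends_sum => i; rewrite summxE; apply: tends_sum => j.
by rewrite mxE [X in _ * X]mxE; apply: tendsM (tends_cst _) (tendsM _ _).
Qed.

(** For a fixed ancilla, input and vector, the quadratic form is a finite linear expression in
    entries that converge by [op_tends_tens]. *)
Lemma op_tends_cp m n (F : nat -> superop R m n) G :
  op_tends F G -> (forall N, completely_positive (F N)) -> completely_positive G.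
Proof.
move=> FG Fcp k X Xpsd v.
apply: (@tends_ge0 (fun N => (v^t* *m tens_op \1%VF (F N) X *m v) 0 0)); last first.
  by move=> N; apply: Fcp.
have -> : (fun N => (v^t* *m tens_op \1%VF (F N) X *m v) 0 0) =
    fun N => \sum_j (\sum_i (v^t*) 0 i * tens_op \1%VF (F N) X i j) * v j 0.
  by apply/funext => N; rewrite mxE; apply: eq_bigr => j _; rewrite mxE.
rewrite mxE; apply: tends_sum => j; rewrite mxE.
apply: tendsM (tends_cst _); apply: tends_sum => i.
by apply: tendsM (tends_cst _) _; apply: op_tends_tens (op_tends_cst _) FG _ _ _.
Qed.

Lemma op_tends_tp m n (F : nat -> superop R m n) G :
  op_tends F G -> (forall N, trace_preserving (F N)) -> trace_preserving G.
Proof.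
move=> FG Ftp X; apply: (@tends_unique (fun N => \tr (F N X))).
  exact: tends_sum (fun i => FG X i i).
by have -> : (fun N => \tr (F N X)) = fun=> \tr X;
  [apply/funext => N; exact: Ftp | exact: tends_cst].
Qed.

End Limits.

(** * Compactness of local operations *)

Section Attained.
Variable R : realType.
Local Notation C := R[i].

(** Each entry is a sum, over Kraus operators, of products of two entries of the same operator. Such
    a product is at most the squared norm of that operator, and these squared norms add up to tr (A
    1). *)
Lemma cp_entry_bound m n (A : superop R m n) : completely_positive A ->
  0 <= \tr (A 1%:M) /\ forall i j k l, `|A (delta_mx i j) k l| <= \tr (A 1%:M).
Proof.
move=> /kraus[r [K ->]].
have trE : \tr ((\sum_r two_sided (K r) (K r)) 1%:M) = \sum_r \tr (K r *m (K r)^t*).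
  rewrite sum_lfunE mxtrace_sum; apply: eq_bigr => s _.
  by rewrite two_sidedE mulmx1.
have tr_ge0 s : 0 <= \tr (K s *m (K s)^t*).
  by rewrite trmx_adjmx; apply: sumr_ge0 => i _; apply: sumr_ge0 => j _; rewrite exprn_ge0.
have K_le s i j : `|K s i j| ^+ 2 <= \tr (K s *m (K s)^t*).
  rewrite trmx_adjmx (bigD1 i) //= (bigD1 j) //= -addrA lerDl addr_ge0 //.
    by apply: sumr_ge0 => j' _; rewrite exprn_ge0.
  by apply: sumr_ge0 => i' _; apply: sumr_ge0 => j' _; rewrite exprn_ge0.
rewrite trE; split=> [|i j k l]; first exact: sumr_ge0.
rewrite sum_lfunE summxE; apply: le_trans (ler_norm_sum _ _ _) _.
apply: ler_sum => s _; rewrite two_sidedE mulmx_deltaE normrM norm_conjC.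
rewrite -(@ler_pXn2r _ 2) ?nnegrE ?mulr_ge0 // exprMn.
by apply: ler_pM; rewrite ?exprn_ge0.
Qed.

(** The traces of the two parts at the identity are nonnegative and add up to n, which bounds all
    entries. Both parts then have limits, and complete positivity and trace preservation are closed
    conditions. *)
Lemma signed_local_limit (lim : (nat -> R) -> R -> Prop) n (F : nat -> superop R n n) :
  is_ultralimit lim -> (forall N, signed_local (F N)) ->
  exists2 G, op_tends lim F G & signed_local G.
Proof.
move=> limP /choice[Ap /choice[Am FE]].
have bound N : forall i j k l, `|Ap N (delta_mx i j) k l| <= ((n%:R : R)%:C) /\
    `|Am N (delta_mx i j) k l| <= ((n%:R : R)%:C).
  have [/cp_entry_bound[p_ge0 p_le] /cp_entry_bound[m_ge0 m_le] [_ tp] _] := FE N.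
  have : \tr (Ap N 1%:M) + \tr (Am N 1%:M) = (n%:R : R)%:C.
    by rewrite -mxtraceD -add_lfunE tp mxtrace1 rmorph_nat.
  move=> <- i j k l; split.
    by apply: le_trans (p_le i j k l) _; rewrite lerDl.
  by apply: le_trans (m_le i j k l) _; rewrite lerDr.
have [Gp ApG] := op_tends_bounded limP (fun N i j k l => (bound N i j k l).1).
have [Gm AmG] := op_tends_bounded limP (fun N i j k l => (bound N i j k l).2).
exists (Gp - Gm).
  have := op_tendsB limP ApG AmG; congr op_tends.
  by apply/funext => N; case: (FE N).
exists Gp, Gm; split; last by [].
- by apply: (op_tends_cp limP ApG) => N; case: (FE N).
- by apply: (op_tends_cp limP AmG) => N; case: (FE N).
- have sumG := op_tendsD limP ApG AmG.
  split; [apply: (op_tends_cp limP sumG)|apply: (op_tends_tp limP sumG)];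
    by move=> N; case: (FE N) => _ _ [].
Qed.

Lemma LO_opp a b (F : superop R (a * b) (a * b)) : LO F -> LO (- F).
Proof.
case=> FA [FB [FAl FBl ->]]; exists (- FA), FB.
by split; [exact: signed_localN|exact: FBl|rewrite tens_opNl].
Qed.

Lemma ultralim_sum (lim : (nat -> R) -> R -> Prop) (I : finType)
    (u : I -> nat -> R) (x : I -> R) :
  is_ultralimit lim -> (forall i, lim (u i) (x i)) ->
  lim (fun n => \sum_i u i n) (\sum_i x i).
Proof.
move=> limP ux.
have -> : (fun n => \sum_i u i n) = \big[(fun u v n => u n + v n)/fun=> 0]_i u i.
  by apply/funext => n; elim/big_rec2: _ => // i v w _ <-.
elim/big_rec2: _ => [|i v w _ vw]; first exact: (ultralim_cst limP).
exact: (ultralimD limP).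
Qed.

(** Decompositions of a common length, with costs within 1/(N+1) of the infimum, converge term by
    term to one whose cost is at most the infimum. *)
Lemma LO_gamma_exists a b (E : superop R (a * b) (a * b)) c0 :
  decomposition_cost (@LO R a b) E c0 ->
  exists2 g, is_gamma (@LO R a b) E g & g <= c0.
Proof.
move=> Ec0; pose S := [set c | decomposition_cost (@LO R a b) E c]%classic.
have S_ge0 : lbound S 0.
  by move=> _ [l [t [F [_ _ _ ->]]]]; apply: sumr_ge0.
have S_inf : has_inf S by split; [exists c0 | exists 0].
pose g := inf S; have g_le c : S c -> g <= c by apply: ge_inf; exists 0.
exists g; last exact: g_le.
split=> //.
have [lim limP] := ultralimit_exists R.
pose coord := superop_coord (a * b) (a * b).
have step (N : nat) : exists tF : ('I_#|coord| -> R) *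
      ('I_#|coord| -> superop R (a * b) (a * b)),
    [/\ forall i, 0 <= tF.1 i, forall i, LO (tF.2 i), E = \sum_i (tF.1 i)%:C *: tF.2 i
      & \sum_i tF.1 i <= g + N.+1%:R^-1].
  have [|c Sc c_lt] := @inf_adherent _ S N.+1%:R^-1 _ S_inf.
    by rewrite invr_gt0 ltr0n.
  have [t [F [t_ge0 LO_F EE tc]]] := decomposition_few_terms (@LO_opp a b) Sc.
  by exists (t, F); split=> //; apply: le_trans tc (ltW c_lt).
have [tF tFP] := choice step.
have t_lim i : exists x, lim (fun N => (tF N).1 i) x.
  apply: (ultralim_bounded limP (M := g + 1)) => N.
  have [t_ge0 _ _ t_le] := tFP N.
  rewrite ger0_norm //; apply: (le_trans (y := \sum_i (tF N).1 i)).
    by rewrite (bigD1 i) //= lerDl sumr_ge0.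
  by apply: le_trans t_le _; rewrite lerD2l invf_le1 ?ler1n ?ltr0n.
have [x xP] := choice t_lim.
(* Limits are taken in each tensor factor separately, so that the limit is again given as a
   product. *)
have F_lim i : exists G, op_tends lim (fun N => (tF N).2 i) G /\ LO G.
  have /choice[FA /choice[FB FE]] : forall N, exists FA FB, [/\ signed_local FA,
      signed_local FB & (tF N).2 i = tens_op FA FB].
    by move=> N; have [_ /(_ i)] := tFP N.
  have [|GA GAlim GAl] := @signed_local_limit lim a FA limP; first by move=> N; case: (FE N).
  have [|GB GBlim GBl] := @signed_local_limit lim b FB limP; first by move=> N; case: (FE N).
  exists (tens_op GA GB); split; last by exists GA, GB.
  have := op_tends_tens limP GAlim GBlim; congr op_tends.
  by apply/funext => N; case: (FE N).
have [G GP] := choice F_lim.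
have EG : E = \sum_i (x i)%:C *: G i.
  apply: (op_tends_unique limP (op_tends_cst limP E)).
  have := op_tends_sum limP (fun i => op_tendsZ limP (tends_real limP (xP i)) (GP i).1).
  by congr op_tends; apply/funext => N; have [_ _ EN _] := tFP N.
have x_ge0 i : 0 <= x i.
  apply: (ultralim_le limP (ultralim_cst limP 0) (xP i)) => N.
  by have [] := tFP N.
have x_le : \sum_i x i <= g.
  have := ultralimD limP (ultralim_cst limP g) (ultralim_harmonic limP).
  rewrite addr0 => gP; apply: (ultralim_le limP (ultralim_sum limP xP) gP) => N.
  by have [] := tFP N.
have [l [t0 [F0 [l_gt0 LO_F0 _ _]]]] := Ec0.
have := decomposition_cost_fin x (LO_F0 (Ordinal l_gt0)) (fun i => (GP i).2).
rewrite -EG (eq_bigr x) => [Sx|i _]; last by rewrite ger0_norm.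
by have /eqP <- : \sum_i x i == g by rewrite eq_le x_le g_le.
Qed.
End Attained.

(** * Orthogonal families and the theorem *)

Section Orthogonal.
Variable R : realType.
Local Notation C := R[i].

(** Evaluate the trace of U^* U twice: unitarity gives ab, and expansion gives ab times the sum,
    since pairs of distinct indices have trace zero. *)
Lemma sum_normc_sqr a b (K : finType) (u : K -> C)
    (L : K -> 'M[C]_a) (Q : K -> 'M[C]_b) :
  (0 < a * b)%N ->
  (forall k, L k \is unitarymx) -> (forall k, Q k \is unitarymx) ->
  (forall k k', k != k' -> \tr ((L k)^t* *m L k') = 0) ->
  \sum_k u k *: (L k *t Q k) \is unitarymx ->
  \sum_k normc (u k) ^+ 2 = 1.
Proof.
move=> ab_gt0 Lu Qu Lo; set U := \sum_k _ => /unitarymxP/mulmx1C UU.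
have N0 : (a * b)%:R != 0 :> C by rewrite pnatr_eq0 -lt0n.
have : \tr (U^t* *m U) = (a * b)%:R * (\sum_k normc (u k) ^+ 2)%:C.
  rewrite adjmx_sum mulmx_suml mxtrace_sum rmorph_sum mulr_sumr; apply: eq_bigr => k _.
  rewrite adjmxZ -scalemxAl mxtraceZ mulmx_sumr mxtrace_sum (bigD1 k) //= big1 => [|k' nk].
    rewrite addr0 -scalemxAr mxtraceZ adjmx_tens tensmx_mul.
    have /unitarymxP/mulmx1C-> := Lu k; have /unitarymxP/mulmx1C-> := Qu k.
    by rewrite tensmx11 mxtrace1 mulrA mulrC -normCKC norm_normc rmorphXn.
  by rewrite -scalemxAr mxtraceZ adjmx_tens tensmx_mul mxtrace_tens Lo 1?eq_sym // mul0r mulr0.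
rewrite UU mxtrace1 -{1}[(a * b)%:R]mulr1 => /(mulfI N0) e.
by apply/complexI; rewrite -e rmorph1.
Qed.

Lemma sqr_sum_offdiag (K : finType) (x : K -> R) :
  (\sum_k x k) ^+ 2 = \sum_k x k ^+ 2 + \sum_k \sum_(k' | k != k') x k * x k'.
Proof.
rewrite expr2 mulr_suml -big_split; apply: eq_bigr => k _.
rewrite mulr_sumr (bigD1 k) //=; congr (_ + _).
by apply: eq_bigl => k'; rewrite eq_sym.
Qed.

(** Carries orthogonality over to the families that have absorbed the outer unitaries. *)
Lemma mxtrace_adjmx_conj n (V W X Y : 'M[C]_n) :
  V \is unitarymx -> W \is unitarymx ->
  \tr ((V *m X *m W)^t* *m (V *m Y *m W)) = \tr (X^t* *m Y).
Proof.
move=> /unitarymxP/mulmx1C VV /unitarymxP WW.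
rewrite !adjmxM mxtrace_mulC !mulmxA -(mulmxA _ W) WW mulmx1.
by rewrite mxtrace_mulC !mulmxA VV mul1mx mxtrace_mulC.
Qed.

Lemma decomposition_cost_sub m n (S S' : superop R m n -> Prop) E c :
  (forall F, S F -> S' F) -> decomposition_cost S E c -> decomposition_cost S' E c.
Proof.
by move=> SS' [l [t [F [l_gt0 SF EE cE]]]]; exists l, t, F; split=> // i; apply: SS'.
Qed.
End Orthogonal.

Theorem theorem5p1 (R : realType) (a b : nat) (ha : (0 < a)%N) (hb : (0 < b)%N)
  (K : finType) (u : K -> R[i])
  (V1 V3 : 'M[R[i]]_a) (V2 V4 : 'M[R[i]]_b)
  (L : K -> 'M[R[i]]_a) (Q : K -> 'M[R[i]]_b) (U : 'M[R[i]]_(a * b))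
  (hV1 : V1 \is unitarymx) (hV2 : V2 \is unitarymx)
  (hV3 : V3 \is unitarymx) (hV4 : V4 \is unitarymx)
  (hL : forall k, L k \is unitarymx) (hQ : forall k, Q k \is unitarymx)
  (hU : U \is unitarymx)
  (hdec : U = (V1 *t V2) *m (\sum_k u k *: (L k *t Q k)) *m (V3 *t V4)) :
  let bound : R := \sum_k normc (u k) ^+ 2 +
    2 * \sum_k \sum_(k' | k != k') normc (u k) * normc (u k') in
  (exists2 g : R, is_gamma (@LO R a b) (unitary_channel U) g & g <= bound) /\
  ((forall k k', k != k' -> \tr ((L k) ^t* *m L k') = 0) ->
   (forall k k', k != k' -> \tr ((Q k) ^t* *m Q k') = 0) ->
   let value : R :=
     1 + 2 * \sum_k \sum_(k' | k != k') normc (u k) * normc (u k') in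
   [/\ is_gamma (@LO R a b) (unitary_channel U) bound,
       is_gamma (@LO R a b) (unitary_channel U) value
     & is_gamma (@LOCC R a b) (unitary_channel U) value]).
Proof.
pose L' k := V1 *m L k *m V3; pose Q' k := V2 *m Q k *m V4.
have L'u k : L' k \is unitarymx by exact: mul_unitarymx (mul_unitarymx hV1 (hL k)) hV3.
have Q'u k : Q' k \is unitarymx by exact: mul_unitarymx (mul_unitarymx hV2 (hQ k)) hV4.
have UE : U = \sum_k u k *: (L' k *t Q' k).
  rewrite hdec mulmx_sumr mulmx_suml; apply: eq_bigr => k _.
  by rewrite -scalemxAr -scalemxAl !tensmx_mul.
move=> bound; have LO_bound : decomposition_cost (@LO R a b) (unitary_channel U) bound.
  by rewrite unitary_channel_two_sided UE; apply: LO_decomposition.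
split=> [|Lo Qo value]; first exact: LO_gamma_exists.
have L'o k k' : k != k' -> \tr ((L' k) ^t* *m L' k') = 0.
  by move=> kk'; rewrite mxtrace_adjmx_conj // Lo.
have Q'o k k' : k != k' -> \tr ((Q' k) ^t* *m Q' k') = 0.
  by move=> kk'; rewrite mxtrace_adjmx_conj // Qo.
have ab_gt0 : (0 < a * b)%N by rewrite muln_gt0 ha hb.
have U'u : \sum_k u k *: (L' k *t Q' k) \is unitarymx by rewrite -UE.
have u1 := sum_normc_sqr ab_gt0 L'u Q'u L'o U'u.
have bound_value : bound = value by rewrite /bound u1.
have value_le c : decomposition_cost (@LOCC R a b) (unitary_channel U) c -> value <= c.
  rewrite unitary_channel_two_sided UE => /(LOCC_cost_lower ab_gt0 L'u Q'u L'o Q'o U'u).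
  (* With S the sum over ordered pairs of distinct indices, the squared sum of the |u_k| is 1 + S,
     and 2 (1 + S) - 1 = 1 + 2 S. *)
  apply: le_trans; rewrite sqr_sum_offdiag u1 /value; lra.
(* Since LO lies in LOCC, the lower bound passes from LOCC to LO, and the decomposition over LO also
   serves for LOCC. *)
have LO_value : is_gamma (@LO R a b) (unitary_channel U) value.
  split=> [|c /(decomposition_cost_sub (@LO_sub_LOCC R a b))]; last exact: value_le.
  by rewrite -bound_value.
rewrite bound_value; split=> //; split=> //.
by case: LO_value => /(decomposition_cost_sub (@LO_sub_LOCC R a b)).
Qed.
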